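(* Let $T\subset\mathbb{R}^3$ be the closed tetrahedron with vertices $(1,1,1)$, $(-1,-1,1)$, $(-1,1,-1)$, $(1,-1,-1)$, and let $G$ be the group of the 12 proper rotations (elements of $SO(3)$) under which $T$ is invariant, which is generated by $$R_1=\begin{pmatrix}0&1&0\\0&0&1\\1&0&0\end{pmatrix},\qquad R_2=\begin{pmatrix}-1&0&0\\0&1&0\\0&0&-1\end{pmatrix}.$$ Let $\mathbf{x}$ be a random point of $T$ with probability density $\mathcal{P}(\mathbf{x})=\frac58|\mathbf{x}|^2$ on $T$, let $w_1(\mathbf{x})=\frac{2}{15|\mathbf{x}|^2}$, and for $f:T\to\mathbb{R}$ define the 13-point stochastic quadrature rule $$Q_M(f)=w_1(\mathbf{x})\left(\sum_{R\in G}f(R\mathbf{x})-12f(0)\right)+\frac83f(0).$$ Then $Q_M$ is of order $2$ and unbiased on $T$.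
   Context: A stochastic quadrature rule on a bounded domain $\Omega_0\subset\mathbb{R}^d$ is a random functional $Q_M(f)=\sum_{j=1}^J f(\mathbf{x}_j)w_j$, where the points and weights $(\mathbf{x}_j,w_j)_{j=1}^J\in(\Omega_0\times\mathbb{R})^J$ are sampled from a probability measure. The rule is of order $p$ if, with probability $1$, $Q_M(f)=\int_{\Omega_0}f(\mathbf{x})\,d\mathbf{x}$ for every polynomial $f$ of (total) degree at most $p$. The rule is unbiased if $\mathbb{E}(Q_M(f))=\int_{\Omega_0}f(\mathbf{x})\,d\mathbf{x}$ for all integrable (everywhere defined) $f:\Omega_0\to\mathbb{R}$. *)

(* Defs.v *)
From HB Require Import structures.
From mathcomp Require Import all_boot all_order all_algebra.
From mathcomp Require Import all_classical all_reals all_analysis.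
From mathcomp Require mpoly.
Import (canonicals, coercions) mpoly.

Set Implicit Arguments.
Unset Strict Implicit.
Unset Printing Implicit Defensive.
Import Order.TTheory GRing.Theory Num.Theory.
Import numFieldNormedType.Exports.

Local Open Scope classical_set_scope.
Local Open Scope ring_scope.

(* Points are triples in [R * R * R], which carries the product (Borel)
   sigma-algebra. [vec] and [unvec] are the mutually inverse translations to
   column vectors, on which matrices act. *)

Notation space R := (R * R * R)%type (only parsing).

Section Space.
Variable R : realType.
Implicit Types (x : space R) (A : 'M[R]_3).

Definition coordinate x (i : 'I_3) : R := tnth [tuple x.1.1; x.1.2; x.2] i.

Definition vec x : 'cV[R]_3 := \col_i coordinate x i.

Definition unvec (u : 'cV[R]_3) : space R :=
  (u (inord 0) 0, u (inord 1) 0, u (inord 2) 0).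

Definition origin : space R := (0, 0, 0).

Definition act A x : space R := unvec (A *m vec x).

(* The squared Euclidean norm; the library norm `|_| on products and matrices
   is the sup norm. *)
Definition sqnorm x : R := \sum_i coordinate x i ^+ 2.

(* Lebesgue measure on the Lebesgue measurable sets, that is, the completion of
   the product measure: sets (hence functions) need not be Borel. *)
Definition lebesgue3 :=
  @completed_measure_extension _ _ _
    ((@lebesgue_measure R \x @lebesgue_measure R) \x @lebesgue_measure R)%E.

End Space.

Arguments lebesgue3 : clear implicits.

(* A random functional on functions on a domain [D] is a map
   [Q : Omega -> (space R -> R) -> R]; functions on [D] are represented by
   functions on the whole space whose values off [D] are irrelevant. *)

Section Quadrature.
Context (R : realType) (d : measure_display) (Omega : measurableType d).
Variables (P : probability Omega R) (D : set (space R)).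
Implicit Type Q : Omega -> (space R -> R) -> R.

Definition stochastic_quadrature (J : nat) Q : Prop :=
  exists (x : 'I_J -> Omega -> space R) (w : 'I_J -> Omega -> R),
    [/\ forall j, measurable_fun [set: Omega] (x j),
        forall j, measurable_fun [set: Omega] (w j),
        forall j omega, D (x j omega) &
        forall omega f, Q omega f = \sum_(j < J) f (x j omega) * w j omega].

(* [msize q <= p.+1] says that the total degree of [q] is at most [p]. *)
Definition of_order (p : nat) Q : Prop :=
  {ae P, forall omega, forall q : mpoly.mpoly 3 R,
    (mpoly.msize q <= p.+1)%N ->
    ((Q omega (fun x => mpoly.meval (coordinate x) q))%:E =
       \int[lebesgue3 R]_(x in D) (mpoly.meval (coordinate x) q)%:E)%E}.

(* [f] is only assumed Lebesgue measurable, so that [Q ^~ f] is in general a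
   random variable for the completion of [P] only: the expectation is taken
   there. It agrees with 'E_P[Q ^~ f] whenever [Q ^~ f] is measurable for the
   sigma-algebra of [Omega]. *)
Definition unbiased Q : Prop :=
  forall f : space R -> R,
    (lebesgue3 R).-integrable D (EFin \o f) ->
    (@completed_measure_extension _ _ _ P).-integrable [set: Omega]
       (fun omega => (Q omega f)%:E) /\
    (\int[@completed_measure_extension _ _ _ P]_omega (Q omega f)%:E =
       \int[lebesgue3 R]_(x in D) (f x)%:E)%E.

End Quadrature.

Section Tetrahedron.
Variable R : realType.

Definition mx3 (rows : seq (seq R)) : 'M[R]_3 :=
  \matrix_(i < 3, j < 3) nth 0 (nth [::] rows i) j.

Definition vertex (k : 'I_4) : space R :=
  tnth [tuple (1, 1, 1); (-1, -1, 1); (-1, 1, -1); (1, -1, -1)] k.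

Definition tetrahedron : set (space R) :=
  [set x | exists t : 'I_4 -> R,
     [/\ forall k, 0 <= t k, \sum_k t k = 1 &
         vec x = \sum_k t k *: vec (vertex k)]].

Definition rotation : set 'M[R]_3 :=
  [set A | A^T *m A = 1%:M /\ \det A = 1].

Definition rotation_group : set 'M[R]_3 :=
  [set A | rotation A /\ act A @` tetrahedron = tetrahedron].

Definition is_subgroup (H : set 'M[R]_3) : Prop :=
  [/\ H `<=` [set A | A \in unitmx], H 1%:M,
      forall A B, H A -> H B -> H (A *m B) &
      forall A, H A -> H (invmx A)].

Definition generated (S : set 'M[R]_3) : set 'M[R]_3 := smallest is_subgroup S.

Definition R1 : 'M[R]_3 := mx3 [:: [:: 0; 1; 0]; [:: 0; 0; 1]; [:: 1; 0; 0]].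

Definition R2 : 'M[R]_3 := mx3 [:: [:: -1; 0; 0]; [:: 0; 1; 0]; [:: 0; 0; -1]].

Definition density (x : space R) : R := 5 / 8 * sqnorm x.

(* At the origin, an event of probability 0, this is 0 by the convention
   0^-1 = 0. *)
Definition w1 (x : space R) : R := 2 / (15 * sqnorm x).

Definition QM (x : space R) (f : space R -> R) : R :=
  w1 x * (\sum_(A \in rotation_group) f (act A x) - 12 * f (origin R))
  + 8 / 3 * f (origin R).

End Tetrahedron.

Arguments tetrahedron : clear implicits.
Arguments rotation_group : clear implicits.
Arguments R1 : clear implicits.
Arguments R2 : clear implicits.

(* Main.v *)
(* An orthogonal matrix preserving the tetrahedron T permutes its vertices, the
   points of T of squared norm 3, which leaves 12 rotations: the cyclic permutation
   matrices with evenly many changes of sign, all of them products of R1 and R2.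
   Lebesgue measure is invariant under R1 and R2, hence under G.

   As w1 * density = 1/12 off the origin, E (w1(x) k(x)) = 1/12 \int_T k. Applying
   this to k = sum_(R in G) f o R - 12 f(0), whose integral over T is
   12 \int_T f - 12 |T| f(0), and using |T| = 8/3, one gets that the rule is
   unbiased. Lebesgue measurable functions are reduced to Borel functions by
   modifying them on a null set.

   If f has degree at most 2, then sum_(R in G) f(R x) = 12 f(0) + e |x|^2 for a
   constant e, so that Q(f) does not depend on x <> 0, and is therefore equal to its
   expectation, the integral of f. *)

(* The obstacle is that [f] is an arbitrary Lebesgue integrable function: the origin is a null set,
   yet [f(0)] enters the rule, so a Borel function equal to [f] almost everywhere may give a
   different rule. The expectation is therefore computed for a rule in which the value at 0 is an
   independent constant [c]; it cancels, because the 12 subtracted copies of [c], averaged with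
   factor 1/12 over [T], amount to the volume 8/3 times [c]. At the other 12 nodes [f] may be
   modified on a null set, since the law of [x] is absolutely continuous and [G] sends null sets to
   null sets; completeness then makes [Q(f)] measurable.

   The weight [w1] blows up at 0, so integrability under the law is not visible directly; it is read
   off after multiplication by the density, which removes the singularity.

   Invariance of the measure comes from symmetries of a product measure, a cyclic permutation and
   changes of sign, and not from determinants. Hence the equality of [G] with the group generated by
   [R1] and [R2] is also an ingredient of unbiasedness. *)
Require Import Defs.
From HB Require Import structures.
From mathcomp Require Import all_boot all_order all_algebra.
From mathcomp Require Import all_classical all_reals all_analysis.
From mathcomp Require mpoly.
Import (canonicals, coercions) mpoly.
From mathcomp Require Import measurable_realfun.
From mathcomp Require Import ring lra.
Set Implicit Arguments.
Unset Strict Implicit.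
Unset Printing Implicit Defensive.
Import Order.TTheory GRing.Theory Num.Theory.
Import numFieldNormedType.Exports.
Local Open Scope classical_set_scope.
Local Open Scope ring_scope.

(** * Integration against the completion of a measure *)

Section Completion.
Context d (T : measurableType d) (R : realType) (mu : {measure set T -> \bar R}).
Local Notation cmu := (@completed_measure_extension _ _ _ mu).
Local Notation cT := (caratheodory_type (mu^*)%mu).

Lemma measurable_completion (A : set T) :
  measurable A -> measurable (A : set cT).
Proof. exact: caratheodory_measurable_mu_ext. Qed.

Lemma completionE (A : set T) : measurable A -> cmu A = mu A.
Proof. exact: measurable_mu_extE. Qed.

Lemma measurable_fun_completion d' (U : measurableType d') (D : set T)
  (f : T -> U) : measurable D -> measurable_fun D f ->
  measurable_fun (D : set cT) f.
Proof. by move=> mD mf _ B mB; exact/measurable_completion/mf. Qed.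

Lemma measurable_completion_id :
  measurable_fun setT (id : cT -> T).
Proof. exact: measurable_fun_completion. Qed.

Local Open Scope ereal_scope.

(** [mu] is the image of its completion under the identity map, so this is a change of variables. *)
Lemma ge0_integral_completion (D : set T) (f : T -> \bar R) :
  measurable D -> measurable_fun D f -> (forall x, D x -> 0 <= f x) ->
  \int[cmu]_(x in D) f x = \int[mu]_(x in D) f x.
Proof.
move=> mD mf f0.
transitivity (\int[pushforward cmu (id : cT -> T)]_(x in D) f x).
  rewrite ge0_integral_pushforward//; first exact: measurable_completion_id.
  by move=> x /[!inE] /f0.
apply: eq_measure_integral => [|mid A mA _]; first exact: measurable_completion_id.
exact: completionE.
Qed.

Lemma integral_completion (D : set T) (f : T -> \bar R) :
  measurable D -> measurable_fun D f ->
  \int[cmu]_(x in D) f x = \int[mu]_(x in D) f x.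
Proof.
move=> mD mf; rewrite [LHS]integralE [RHS]integralE.
by rewrite !ge0_integral_completion//;
  [exact: measurable_funeneg|exact: measurable_funepos].
Qed.

Lemma integrable_completion (D : set T) (f : T -> \bar R) : measurable D ->
  mu.-integrable D f -> cmu.-integrable D f.
Proof.
move=> mD /integrableP[mf foo]; apply/integrableP; split.
  exact: measurable_fun_completion.
by rewrite ge0_integral_completion//; exact: measurableT_comp.
Qed.

Lemma ae_eq_completion (D N : set T) (f g : T -> \bar R) : measurable D ->
  measurable N -> mu N = 0 -> (forall x, D x -> ~ N x -> f x = g x) ->
  ae_eq cmu D f g.
Proof.
move=> mD mN N0 fg; exists N; split; first exact: measurable_completion.
  by rewrite -[RHS]N0; exact: completionE.
by move=> x /= /not_implyP[Dx fgx]; apply: contrapT => /(fg _ Dx).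
Qed.

Lemma completion_is_complete : measure_is_complete cmu.
Proof. exact: measure_is_complete_caratheodory. Qed.

(** No measurability of [g] is assumed: it follows from completeness. With [mu := P], this handles
    random variables known only off a null event. *)
Lemma integral_completion_ae (D N : set T) (f g : T -> \bar R) :
  measurable D -> measurable N -> mu N = 0 ->
  (forall x, D x -> ~ N x -> f x = g x) -> mu.-integrable D f ->
  cmu.-integrable D g /\ \int[cmu]_(x in D) g x = \int[mu]_(x in D) f x.
Proof.
move=> mD mN N0 fg intf; have mf := measurable_int _ intf.
have mD' := measurable_completion mD.
have aefg := ae_eq_completion mD mN N0 fg.
have mg : measurable_fun (D : set cT) g.
  exact: (ae_measurable_fun completion_is_complete aefg
    (measurable_fun_completion mD mf)).
split; last first.
  rewrite -(integral_completion mD mf); apply/esym/ae_eq_integral => //.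
  exact: measurable_fun_completion.
have /integrableP[mf' foo] := integrable_completion mD intf.
apply/integrableP; split => //; apply: le_lt_trans foo.
rewrite le_eqVlt; apply/orP; left; apply/eqP.
apply/esym/ae_eq_integral => //; try exact: measurableT_comp.
by apply: filterS aefg => x fgx /fgx ->.
Qed.

End Completion.

(** * Measurable functions for the completion are Borel up to a null set *)

Section BorelApproximation.
Context d (T : measurableType d) (R : realType) (mu : {measure set T -> \bar R}).
Local Notation cmu := (@completed_measure_extension _ _ _ mu).
Local Notation cT := (caratheodory_type (mu^*)%mu).

(** The outer measure is an infimum over countable measurable covers; [B] is the intersection of
    covers whose excess is at most [1 / (n + 1)]. *)
Lemma measurable_hull (X : set T) : ((mu^*)%mu X < +oo)%E ->
  exists B, [/\ measurable B, X `<=` B & mu B = (mu^*)%mu X].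
Proof.
move=> Xoo.
have Xfin : (mu^*)%mu X \is a fin_num by rewrite ge0_fin_numE// outer_measure_ge0.
have /choice[F FP] : forall n : nat, exists F : (set T)^nat,
    measurable_cover X F /\
    (\sum_(k <oo) mu (F k) <= (mu^*)%mu X + (n.+1%:R^-1)%:E)%E.
  move=> n; have n0 : 0 < n.+1%:R^-1 :> R by [].
  have [_ [F FX <-] Fn] := lb_ereal_inf_adherent n0 Xfin.
  by exists F; split => //; exact: ltW.
have mF n k : measurable (F n k) by have [[]] := FP n.
pose B := \bigcap_n \bigcup_k F n k.
have mB : measurable B.
  by apply: bigcapT_measurable => n; exact: bigcupT_measurable.
have XB : X `<=` B by move=> x Xx n _; have [[_ +] _] := FP n; exact.
exists B; split => //; apply/eqP; rewrite eq_le; apply/andP; split; last first.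
  by rewrite -(measurable_mu_extE mu mB); exact: le_outer_measure.
apply/lee_addgt0Pr => e e0.
have [n ne] : exists n : nat, n.+1%:R^-1 < e.
  by exists (Num.truncn e^-1); rewrite invf_plt ?posrE// truncnS_gt.
have [_ Fn] := FP n; apply: (@le_trans _ _ ((mu^*)%mu X + (n.+1%:R^-1)%:E)%E).
  apply: le_trans Fn; apply: le_trans (_ : mu (\bigcup_k F n k) <= _)%E; last first.
    by apply: measure_sigma_subadditive => //; exact: bigcupT_measurable.
  apply: le_measure; rewrite ?inE//; first exact: bigcupT_measurable.
  exact: bigcap_inf.
by rewrite leeD2l// lee_fin ltW.
Qed.

(** Take a hull [B] of [E]. Splitting [B] along [E] by the Caratheodory criterion shows that [B \ E]
    has outer measure 0, finiteness allowing the subtraction; [N] is a hull of [B \ E]. *)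
Lemma completion_measurable_ae (E : set T) :
  measurable (E : set cT) -> ((mu^*)%mu E < +oo)%E ->
  exists B N, [/\ measurable B, measurable N, mu N = 0%E &
    forall x, ~ N x -> (E x <-> B x)].
Proof.
move=> mE Eoo; have [B [mB EB muB]] := measurable_hull Eoo.
have BE0 : (mu^*)%mu (B `\` E) = 0%E.
  have Efin : (mu^*)%mu E \is a fin_num by rewrite ge0_fin_numE// outer_measure_ge0.
  have : ((mu^*)%mu B = (mu^*)%mu (B `&` E) + (mu^*)%mu (B `&` ~` E))%E := mE B.
  rewrite (setIidr EB) (measurable_mu_extE mu mB) muB => /eqP.
  by rewrite -setDE addeC -sube_eq// ?fin_num_adde_defl// subee// => /eqP <-.
have [|N [mN BN muN]] := @measurable_hull (B `\` E); first by rewrite BE0.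
exists B, N; split => //; first by rewrite muN.
by move=> x Nx; split; [exact: EB|move=> Bx; apply: contrapT => Ex; apply/Nx/BN].
Qed.

(** A real function is determined by its superlevel sets at rational levels. Each is replaced by a
    Borel set, and the countably many null sets where they differ are discarded. *)
Lemma completion_measurable_fun_ae (D : set T) (g : T -> R) :
  measurable D -> (mu D < +oo)%E -> measurable_fun (D : set cT) g ->
  exists f N, [/\ measurable_fun setT f, measurable N, mu N = 0%E &
    forall x, D x -> ~ N x -> f x = g x].
Proof.
move=> mD Doo mg.
pose E (q : rat) := D `&` g @^-1` `]ratr q, +oo[.
have mE q : measurable (E q : set cT).
  by apply: mg => //; exact: measurable_completion.
have Eoo q : ((mu^*)%mu (E q) < +oo)%E.
  apply: le_lt_trans Doo; rewrite -(measurable_mu_extE mu mD).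
  by apply: le_outer_measure; exact: subIsetl.
have /choice[BN BNP] : forall q, exists BN : set T * set T,
    [/\ measurable BN.1, measurable BN.2, mu BN.2 = 0%E &
    forall x, ~ BN.2 x -> (E q x <-> BN.1 x)].
  move=> q; have [B [N ?]] := completion_measurable_ae (mE q) (Eoo q).
  by exists (B, N).
(* The rationals are enumerated by their codes; a number that codes no rational gives 0, which only
   repeats a set. *)
pose N := \bigcup_n (BN (odflt 0 (unpickle n))).2.
have mN : measurable N.
  by apply: bigcupT_measurable => n; have [] := BNP (odflt 0 (unpickle n)).
have N0 : mu N = 0%E.
  apply: measure_negligible => //; apply: negligible_bigcup => n.
  by have [_ ? ? _] := BNP (odflt 0 (unpickle n)); exact/negligibleP.
have NN q : (BN q).2 `<=` N by move=> x Nx; exists (pickle q); rewrite // pickleK.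
pose f := g \_ (D `\` N).
exists f, N; split => //; last first.
  by move=> x Dx Nx; rewrite /f patchE mem_set.
(* Outside [D \ N] the value of [f] is 0, which exceeds [x] exactly when [x < 0]; hence the last
   term. *)
have fE (x : R) : f @^-1` `]x, +oo[ =
   ((D `\` N) `&` \bigcup_(q in [set q : rat | x < ratr q]) (BN q).1) `|`
   (if x < 0 then ~` (D `\` N) else set0).
  apply/seteqP; split => [y|y].
    rewrite /= in_itv/= andbT /f patchE; case: ifPn => [/[!inE] -[Dy Ny] xg|].
      left; split => //.
      have [q] := rat_in_itvoo xg; rewrite in_itv/= => /andP[xq qg].
      exists q => //; have [_ _ _ +] := BNP q.
      move=> /(_ y) [|+ _]; last by apply; split => //=; rewrite in_itv/= qg.
      by move/NN.
    by rewrite notin_setE => Dy x0; right; rewrite x0.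
  move=> [[[Dy Ny] [q /= xq Bq]]|].
    rewrite /= in_itv/= andbT /f patchE mem_set//.
    have [_ _ _ +] := BNP q; move=> /(_ y)[|_ /(_ Bq)[_]].
      by move/NN.
    by rewrite /= in_itv/= andbT; exact: lt_trans.
  case: ifPn => // x0 nDy; rewrite /= in_itv/= andbT /f patchE memNset//.
apply: (measurability _ (RGenOInfty.measurableE R)) => _ [_ [x ->] <-].
rewrite setTI fE; apply: measurableU.
  apply: measurableI; first exact: measurableD.
  rewrite bigcup_mkcond; apply: bigcupT_measurable_rat => q.
  by case: ifPn => // _; have [] := BNP q.
by case: ifPn => // _; apply: measurableC; exact: measurableD.
Qed.

End BorelApproximation.

(** * The tetrahedron and its rotations in coordinates *)

Section Geometry.
Variable R : realType.
Implicit Types (A B : 'M[R]_3) (x : R * R * R).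

Definition mat a b c a' b' c' a'' b'' c'' : 'M[R]_3 :=
  mx3 [:: [:: a; b; c]; [:: a'; b'; c']; [:: a''; b''; c'']].

Lemma ord3P (P : 'I_3 -> Prop) :
  P (inord 0) -> P (inord 1) -> P (inord 2) -> forall i, P i.
Proof.
move=> P0 P1 P2 [[|[|[|//]]] i3]; [move: P0|move: P1|move: P2];
  by congr P; apply: val_inj; rewrite /= inordK.
Qed.

Lemma big_ord3 (V : zmodType) (F : 'I_3 -> V) :
  \sum_i F i = F (inord 0) + F (inord 1) + F (inord 2).
Proof.
rewrite 3!big_ord_recr big_ord0 /= add0r.
by congr (F _ + F _ + F _); apply: val_inj; rewrite /= inordK.
Qed.

Lemma matE A : A = mat (A (inord 0) (inord 0)) (A (inord 0) (inord 1))
  (A (inord 0) (inord 2)) (A (inord 1) (inord 0)) (A (inord 1) (inord 1))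
  (A (inord 1) (inord 2)) (A (inord 2) (inord 0)) (A (inord 2) (inord 1))
  (A (inord 2) (inord 2)).
Proof.
by apply/matrixP; do 2 apply: ord3P; rewrite !mxE !inordK.
Qed.

Lemma mulmx_mat a b c d e f g h i a' b' c' d' e' f' g' h' i' :
  mat a b c d e f g h i *m mat a' b' c' d' e' f' g' h' i' =
  mat (a * a' + b * d' + c * g') (a * b' + b * e' + c * h')
      (a * c' + b * f' + c * i') (d * a' + e * d' + f * g')
      (d * b' + e * e' + f * h') (d * c' + e * f' + f * i')
      (g * a' + h * d' + i * g') (g * b' + h * e' + i * h')
      (g * c' + h * f' + i * i').
Proof.
by apply/matrixP; do 2 apply: ord3P; rewrite !mxE big_ord3 !mxE !inordK.
Qed.

Lemma trmx_mat a b c d e f g h i :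
  (mat a b c d e f g h i)^T = mat a d g b e h c f i.
Proof. by apply/matrixP; do 2 apply: ord3P; rewrite !mxE !inordK. Qed.

Lemma mat1 : 1%:M = mat 1 0 0 0 1 0 0 0 1.
Proof. by apply/matrixP; do 2 apply: ord3P; rewrite !mxE -val_eqE/= !inordK. Qed.

Lemma det_mat a b c d e f g h i : \det (mat a b c d e f g h i) =
  a * (e * i - f * h) - b * (d * i - f * g) + c * (d * h - e * g).
Proof.
rewrite (expand_det_row _ ord0) !big_ord_recl big_ord0 /cofactor.
rewrite !(expand_det_row _ ord0) !big_ord_recl !big_ord0 /cofactor !det_mx11.
rewrite !mxE /= /bump /=; ring.
Qed.

Lemma act_mat a b c d e f g h i u v w :
  act (mat a b c d e f g h i) (u, v, w) =
  (a * u + b * v + c * w, d * u + e * v + f * w, g * u + h * v + i * w).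
Proof.
by rewrite /act /unvec !mxE !big_ord3 !mxE /coordinate !(tnth_nth 0) /= !inordK.
Qed.

Lemma sqnorm3 u v w : sqnorm (u, v, w) = u ^+ 2 + v ^+ 2 + w ^+ 2 :> R.
Proof. by rewrite /sqnorm big_ord3 /coordinate !(tnth_nth 0) /= !inordK. Qed.

(** The four affine forms are 4 times the barycentric coordinates. *)
Lemma tetrahedron3 u v w : tetrahedron R (u, v, w) <->
  [/\ 0 <= 1 + u + v + w, 0 <= 1 - u - v + w, 0 <= 1 - u + v - w &
      0 <= 1 + u - v - w].
Proof.
split=> [[t [t0 t1 xt]]|[h0 h1 h2 h3]].
  have /matrixP E := xt.
  have := E (inord 0) 0; have := E (inord 1) 0; have := E (inord 2) 0.
  move: t1; rewrite !mxE !summxE !big_ord_recr !big_ord0 /= !mxE.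
  rewrite /coordinate !(tnth_nth 0) /= !inordK//= => t1 -> -> ->.
  set t_0 := t (widen_ord _ (widen_ord _ (widen_ord _ ord_max))) in t1 *.
  set t_1 := t (widen_ord _ (widen_ord _ ord_max)) in t1 *.
  set t_2 := t (widen_ord _ ord_max) in t1 *.
  set t_3 := t ord_max in t1 *.
  have p0 : 0 <= t_0 by exact: t0.
  have p1 : 0 <= t_1 by exact: t0.
  have p2 : 0 <= t_2 by exact: t0.
  have p3 : 0 <= t_3 by exact: t0.
  split; lra.
exists (fun k : 'I_4 => nth 0 [:: 1 + u + v + w; 1 - u - v + w; 1 - u + v - w;
  1 + u - v - w] k / 4).
split.
- move=> [[|[|[|[|//]]]] ?] /=; lra.
- rewrite !big_ord_recr !big_ord0 /=; lra.
- apply/matrixP; apply: ord3P => j; rewrite ord1 !mxE summxE;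
    rewrite !big_ord_recr !big_ord0 /= !mxE /coordinate !(tnth_nth 0) /=;
    rewrite !inordK//=; lra.
Qed.

(* The cyclic permutation matrices with evenly many changes of sign. *)
Definition rots : seq 'M[R]_3 :=
  [:: mat 1 0 0 0 1 0 0 0 1;
      mat (-1) 0 0 0 1 0 0 0 (-1);
      mat 1 0 0 0 (-1) 0 0 0 (-1);
      mat (-1) 0 0 0 (-1) 0 0 0 1;
      mat 0 1 0 0 0 1 1 0 0;
      mat 0 (-1) 0 0 0 1 (-1) 0 0;
      mat 0 1 0 0 0 (-1) (-1) 0 0;
      mat 0 (-1) 0 0 0 (-1) 1 0 0;
      mat 0 0 1 1 0 0 0 1 0;
      mat 0 0 (-1) 1 0 0 0 (-1) 0;
      mat 0 0 1 (-1) 0 0 0 (-1) 0;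
      mat 0 0 (-1) (-1) 0 0 0 1 0].

Lemma R1E : R1 R = mat 0 1 0 0 0 1 1 0 0. Proof. by []. Qed.

Lemma R2E : R2 R = mat (-1) 0 0 0 1 0 0 0 (-1). Proof. by []. Qed.

Lemma vecK : cancel (@vec R) (@unvec R).
Proof.
by move=> [[u v] w]; rewrite /unvec !mxE /coordinate !(tnth_nth 0) /= !inordK.
Qed.

Lemma unvecK : cancel (@unvec R) (@vec R).
Proof.
move=> u; apply/matrixP; apply: ord3P => j;
  by rewrite ord1 !mxE /coordinate !(tnth_nth 0) /= inordK.
Qed.

Lemma act_mul A B x : act (A *m B) x = act A (act B x).
Proof. by rewrite /act unvecK mulmxA. Qed.

Lemma act1 x : act 1%:M x = x.
Proof. by rewrite /act mul1mx vecK. Qed.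

Lemma rotation_unit A : rotation A -> A \in unitmx.
Proof. by move=> [/mulmx1_unit[]]. Qed.

Lemma rotation_invmx A : rotation A -> invmx A = A^T.
Proof.
move=> rA; have uA := rotation_unit rA; case: rA => AA _.
by rewrite -[LHS]mul1mx -AA -mulmxA mulmxV// mulmx1.
Qed.

Lemma rotation_group_subgroup : is_subgroup (rotation_group R).
Proof.
split.
- by move=> A [/rotation_unit].
- split; first by split; [rewrite trmx1 mulmx1|exact: det1].
  by apply/seteqP; split=> [_ [x Tx <-]|x Tx]; [|exists x => //]; rewrite act1.
- move=> A B [[AA dA] TA] [[BB dB] TB]; split; [split|].
  + by rewrite trmx_mul -mulmxA (mulmxA A^T) AA mul1mx.
  + by rewrite det_mulmx dA dB mulr1.
  + rewrite -[RHS]TA -[in RHS]TB image_comp.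
    by apply: eq_imagel => x _; exact: act_mul.
- move=> A [rA TA]; have uA := rotation_unit rA; split; [split|].
  + rewrite (rotation_invmx rA) trmxK -(rotation_invmx rA); exact: mulmxV.
  + by rewrite (rotation_invmx rA) det_tr; case: rA.
  + rewrite -[in LHS]TA image_comp -[RHS]image_id; apply: eq_imagel => x _.
    by rewrite /= -act_mul mulVmx// act1.
Qed.

Lemma rotation_group_R1 : rotation_group R (R1 R).
Proof.
rewrite R1E; split; [split|].
- by rewrite trmx_mat mulmx_mat mat1; congr mat; ring.
- by rewrite det_mat; ring.
- apply/seteqP; split=> [_ [[[u v] w] /tetrahedron3[? ? ? ?] <-]|[[u v] w]].
    by rewrite act_mat; apply/tetrahedron3; split; lra.
  move=> /tetrahedron3[? ? ? ?]; exists (w, u, v).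
    by apply/tetrahedron3; split; lra.
  by rewrite act_mat; congr (_, _, _); ring.
Qed.

Lemma rotation_group_R2 : rotation_group R (R2 R).
Proof.
rewrite R2E; split; [split|].
- by rewrite trmx_mat mulmx_mat mat1; congr mat; ring.
- by rewrite det_mat; ring.
- apply/seteqP; split=> [_ [[[u v] w] /tetrahedron3[? ? ? ?] <-]|[[u v] w]].
    by rewrite act_mat; apply/tetrahedron3; split; lra.
  move=> /tetrahedron3[? ? ? ?]; exists (- u, v, - w).
    by apply/tetrahedron3; split; lra.
  by rewrite act_mat; congr (_, _, _); ring.
Qed.

Lemma generated_sub_rotation_group :
  generated [set R1 R; R2 R] `<=` rotation_group R.
Proof.
apply: smallest_sub; first exact: rotation_group_subgroup.
by move=> _ [->|->]; [exact: rotation_group_R1|exact: rotation_group_R2].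
Qed.

(** The group is a Klein four-group [V] of diagonal matrices extended by the cyclic group of order 3
    of [R1]: its elements are [V], [V R1] and [V R1^2]. *)
Lemma rots_generated A : A \in rots -> generated [set R1 R; R2 R] A.
Proof.
move=> + H [[_ H1 HM _] HR].
have {}HR1 : H (R1 R) by apply: HR; left.
have {HR}HR2 : H (R2 R) by apply: HR; right.
have HRR := HM _ _ HR1 HR1.
(* As [R1^3 = 1], these are the conjugates of [R2] by [R1] and by its inverse, namely the half-turns
   diag(1, -1, -1) and diag(-1, -1, 1), which complete [V]. *)
have Hb := HM _ _ (HM _ _ HR1 HR2) HRR.
have Hc := HM _ _ HRR (HM _ _ HR2 HR1).
have Q0 := HM _ _ H1 HR1; have Q1 := HM _ _ HR2 HR1.
have Q2 := HM _ _ Hb HR1; have Q3 := HM _ _ Hc HR1.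
have S0 := HM _ _ H1 HRR; have S1 := HM _ _ HR2 HRR.
have S2 := HM _ _ Hb HRR; have S3 := HM _ _ Hc HRR.
rewrite R1E R2E mat1 !mulmx_mat in H1 HR2 Hb Hc Q0 Q1 Q2 Q3 S0 S1 S2 S3.
move: H1 HR2 Hb Hc Q0 Q1 Q2 Q3 S0 S1 S2 S3.
rewrite !(mul0r, mulr0, mul1r, mulr1, addr0, add0r, mulrNN, mulN1r, mulrN1).
rewrite ?opprK ?oppr0.
by do 12![move=> ?]; do 12!case/predU1P => [->//|].
Qed.

End Geometry.

(** * Classification of the rotations by their action on the vertices *)

Section RotationGroup.
Variable R : realType.
Implicit Types (A B : 'M[R]_3) (x : R * R * R).

(** The forms [p0], ..., [p3] are nonnegative with sum 4, and their squares add up to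
    [4 + 4 |x|^2 = 16]. So the products of two different forms have sum 0, each of them vanishes,
    and only one form is nonzero. *)
Lemma tetrahedron_sqnorm3 u v w : tetrahedron R (u, v, w) ->
  sqnorm (u, v, w) = 3 ->
  (u, v, w) \in [:: (1, 1, 1); (-1, -1, 1); (-1, 1, -1); (1, -1, -1)].
Proof.
rewrite sqnorm3 => /tetrahedron3; set p0 := 1 + u + v + w.
set p1 := 1 - u - v + w; set p2 := 1 - u + v - w; set p3 := 1 + u - v - w.
move=> [h0 h1 h2 h3] n3.
have E : p0 * p1 + p0 * p2 + p0 * p3 + p1 * p2 + p1 * p3 + p2 * p3 = 0.
  by rewrite /p0 /p1 /p2 /p3; lra.
have h01 := mulr_ge0 h0 h1; have h02 := mulr_ge0 h0 h2.
have h03 := mulr_ge0 h0 h3; have h12 := mulr_ge0 h1 h2.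
have h13 := mulr_ge0 h1 h3; have h23 := mulr_ge0 h2 h3.
have /eqP e01 : p0 * p1 = 0 by lra.
have /eqP e02 : p0 * p2 = 0 by lra.
have /eqP e03 : p0 * p3 = 0 by lra.
have /eqP e12 : p1 * p2 = 0 by lra.
have /eqP e13 : p1 * p3 = 0 by lra.
have /eqP e23 : p2 * p3 = 0 by lra.
have S : p0 + p1 + p2 + p3 = 4 by rewrite /p0 /p1 /p2 /p3; lra.
have close a b c : u = a -> v = b -> w = c -> (u, v, w) = (a, b, c).
  by move=> -> -> ->.
rewrite !mulf_eq0 in e01 e02 e03 e12 e13 e23.
rewrite !inE; apply/or4P.
have [p0E|p0N] := eqVneq p0 0; last first.
  move: e01 e02 e03; rewrite (negPf p0N) /= => /eqP E1 /eqP E2 /eqP E3.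
  constructor 1; apply/eqP; apply: close; rewrite /p0 /p1 /p2 /p3 in E1 E2 E3; lra.
have [p1E|p1N] := eqVneq p1 0; last first.
  move: e12 e13; rewrite (negPf p1N) /= => /eqP E2 /eqP E3.
  constructor 2; apply/eqP; apply: close; rewrite /p0 /p1 /p2 /p3 in p0E E2 E3; lra.
have [p2E|p2N] := eqVneq p2 0; last first.
  move: e23; rewrite (negPf p2N) /= => /eqP E3.
  constructor 3; apply/eqP; apply: close; rewrite /p0 /p1 /p2 /p3 in p0E p1E E3; lra.
constructor 4; apply/eqP; apply: close; rewrite /p0 /p1 /p2 /p3 in p0E p1E p2E; lra.
Qed.

(* [A] permutes the vertices, which are the points of the tetrahedron of squared
   norm 3, and its columns are minus half the sums of the images of the last
   three vertices, taken two by two. *)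
Lemma rotation_group_rots A : rotation_group R A -> A \in rots R.
Proof.
rewrite (matE A).
move: (A _ _) (A _ _) (A _ _) (A _ _) (A _ _) (A _ _) (A _ _) (A _ _) (A _ _).
move=> i h g f e d c b a [[orth det1] AT].
have V (u v w : R) : (u, v, w) \in [:: (-1, -1, 1); (-1, 1, -1); (1, -1, -1)] ->
   act (mat a b c d e f g h i) (u, v, w) \in
     [:: (1, 1, 1); (-1, -1, 1); (-1, 1, -1); (1, -1, -1)].
  move=> Vx; rewrite act_mat; apply: tetrahedron_sqnorm3.
    rewrite -act_mat -AT; exists (u, v, w) => //. apply/tetrahedron3.
    by move: Vx; rewrite !inE => /or3P[] /eqP[-> -> ->]; split; lra.
  have UVW : u ^+ 2 = 1 /\ v ^+ 2 = 1 /\ w ^+ 2 = 1.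
    by move: Vx; rewrite !inE => /or3P[] /eqP[-> -> ->]; split => //; lra.
  move: UVW => [u2 [v2 w2]].
  move: orth; rewrite trmx_mat mulmx_mat mat1 => /matrixP orth.
  have := orth (inord 0) (inord 0); have := orth (inord 1) (inord 1).
  have := orth (inord 2) (inord 2); have := orth (inord 0) (inord 1).
  have := orth (inord 0) (inord 2); have := orth (inord 1) (inord 2).
  rewrite !mxE !inordK//= => o12 o02 o01 o22 o11 o00; rewrite sqnorm3.
  (* Grouped by inner products of the columns, which orthogonality evaluates. *)
  transitivity ((a * a + d * d + g * g) * u ^+ 2
    + (b * b + e * e + h * h) * v ^+ 2 + (c * c + f * f + i * i) * w ^+ 2
    + 2 * ((a * b + d * e + g * h) * u * v + (a * c + d * f + g * i) * u * w
    + (b * c + e * f + h * i) * v * w)); first by ring.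
  by rewrite o12 o02 o01 o22 o11 o00 u2 v2 w2; ring.
have := V (-1) (-1) 1; have := V (-1) 1 (-1); have := V 1 (-1) (-1).
rewrite !act_mat !inE !eqxx ?orbT => /(_ isT) V3 /(_ isT) V2 /(_ isT) V1.
rewrite det_mat in det1.
pose m (s t : R) : R := - (s + t) / 2.
have {V AT orth} [p1 p2 p3] : [/\
    [/\ a = m (a * -1 + b * -1 + c * 1) (a * -1 + b * 1 + c * -1),
        d = m (d * -1 + e * -1 + f * 1) (d * -1 + e * 1 + f * -1) &
        g = m (g * -1 + h * -1 + i * 1) (g * -1 + h * 1 + i * -1)],
    [/\ b = m (a * -1 + b * -1 + c * 1) (a * 1 + b * -1 + c * -1),
        e = m (d * -1 + e * -1 + f * 1) (d * 1 + e * -1 + f * -1) &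
        h = m (g * -1 + h * -1 + i * 1) (g * 1 + h * -1 + i * -1)] &
    [/\ c = m (a * -1 + b * 1 + c * -1) (a * 1 + b * -1 + c * -1),
        f = m (d * -1 + e * 1 + f * -1) (d * 1 + e * -1 + f * -1) &
        i = m (g * -1 + h * 1 + i * -1) (g * 1 + h * -1 + i * -1)]].
  by rewrite /m; split; split; field.
have m11 : m 1 1 = -1 by rewrite /m; lra.
have m1N : m 1 (-1) = 0 by rewrite /m; lra.
have mN1 : m (-1) 1 = 0 by rewrite /m; lra.
have mNN : m (-1) (-1) = 1 by rewrite /m; lra.
have mE := (m11, m1N, mN1, mNN).
(* From here on [m] is an arbitrary function with four known values, and the coordinates of the
   images are variables, so that each case below reduces to rewriting. *)
move: p1 p2 p3 V1 V2 V3; rewrite -/m; move: (m) mE => {m m11 m1N mN1 mNN} m mE.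
move: (a * -1 + b * -1 + c * 1) (d * -1 + e * -1 + f * 1)
  (g * -1 + h * -1 + i * 1) (a * -1 + b * 1 + c * -1) (d * -1 + e * 1 + f * -1)
  (g * -1 + h * 1 + i * -1) (a * 1 + b * -1 + c * -1) (d * 1 + e * -1 + f * -1)
  (g * 1 + h * -1 + i * -1) => u1 u2 u3 v1 v2 v3 w1 w2 w3.
move=> [pa pd pg] [pb pe ph] [pc pf pi]; subst a b c d e f g h i.
(* Of the 64 choices of images for three vertices, 12 give a matrix of the list; in the other ones
   the determinant is 0 or -1. *)
case/or4P => /eqP[? ? ?]; case/or4P => /eqP[? ? ?]; case/or4P => /eqP[? ? ?];
  subst u1 u2 u3 v1 v2 v3 w1 w2 w3; rewrite !mE in det1 *;
  first [by exfalso; lra | by rewrite eqxx ?orbT].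
Qed.

End RotationGroup.

(** * Generation by [R1] and [R2], and the order of the group *)

Section RotationGroupE.
Variable R : realType.
Implicit Types (A B : 'M[R]_3) (x : R * R * R).

Lemma rotation_groupE : rotation_group R = [set` rots R].
Proof.
apply/seteqP; split=> [A /rotation_group_rots//|A].
by move/rots_generated; exact: generated_sub_rotation_group.
Qed.

Lemma rotation_group_generated :
  rotation_group R = generated [set R1 R; R2 R].
Proof.
apply/seteqP; split; last exact: generated_sub_rotation_group.
by move=> A /rotation_group_rots/rots_generated.
Qed.

Lemma rots_uniq : uniq (rots R).
Proof.
(* 50 + p + 10 * q, where [(p, q, _)] is the image of [(1, 2, 4)] under [A]. *)
pose code A := 50 + A (inord 0) (inord 0) + 2 * A (inord 0) (inord 1)
  + 4 * A (inord 0) (inord 2) + 10 * A (inord 1) (inord 0)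
  + 20 * A (inord 1) (inord 1) + 40 * A (inord 1) (inord 2).
(* Equality in [R] does not compute; the codes are natural numbers, on which distinctness does. *)
apply: (@map_uniq _ _ code).
have -> : map code (rots R) = map (fun n => n%:R)
    [:: 71; 69; 31; 29; 92; 88; 12; 8; 64; 56; 44; 36]%N.
  have step (a b : R) s t : a = b -> s = t -> a :: s = b :: t by move=> -> ->.
  by rewrite /code /= !mxE !inordK//=; do 12?[apply: (step); first lra].
by rewrite map_inj_uniq// => m n /eqP; rewrite eqr_nat => /eqP.
Qed.

Lemma rotation_group_card : (rotation_group R #= `I_12)%card.
Proof.
rewrite rotation_groupE.
have -> : [set` rots R] = nth 0 (rots R) @` `I_12.
  apply/seteqP; split=> [A /= /(nthP 0)[n n12 <-]|_ [n n12 <-]]; first by exists n.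
  exact: mem_nth.
apply: inj_card_eq => m n; rewrite !inE /= => m12 n12 /eqP.
by rewrite nth_uniq ?rots_uniq// => /eqP.
Qed.

Lemma rotation_group_sum (F : 'M[R]_3 -> R) :
  \sum_(A \in rotation_group R) F A = \sum_(A <- rots R) F A.
Proof. by rewrite rotation_groupE -fsbig_seq// rots_uniq. Qed.

End RotationGroupE.

(** * Sums of polynomials of degree at most 2 over orbits *)

Section Moments.
Variable R : realType.
Implicit Types (q : R * R * R -> R).

Definition monomial3 (i j k : nat) (x : R * R * R) : R :=
  x.1.1 ^+ i * x.1.2 ^+ j * x.2 ^+ k.

Definition monomialm (m : mpoly.multinom 3) : R * R * R -> R :=
  monomial3 (m (inord 0)) (m (inord 1)) (m (inord 2)).

Lemma meval3 (q : mpoly.mpoly 3 R) (x : R * R * R) :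
  mpoly.meval (coordinate x) q = \sum_(m <- mpoly.msupp q)
    mpoly.mcoeff m q * monomialm m x.
Proof.
rewrite mpoly.mevalE; apply: eq_bigr => m _; congr (_ * _).
rewrite 3!big_ord_recr big_ord0 /= mul1r /monomialm /monomial3.
congr (_ ^+ _ * _ ^+ _ * _ ^+ _); congr (m _);
  by apply: val_inj; rewrite /= inordK.
Qed.

Lemma degree3 (q : mpoly.mpoly 3 R) (n : nat) (m : mpoly.multinom 3) :
  (mpoly.msize q <= n.+1)%N ->
  m \in mpoly.msupp q ->
  (m (inord 0) + m (inord 1) + m (inord 2) <= n)%N.
Proof.
move=> qn /mpoly.msize_mdeg_lt mq; have := leq_trans mq qn.
rewrite ltnS mpoly.mdegE 3!big_ord_recr big_ord0 /= add0n; apply: etrans.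
by congr (_ + _ + _ <= _)%N; congr (m _); apply: val_inj; rewrite /= inordK.
Qed.

(* The average of [q] over the group is the one over all of SO(3) would be, were
   [q] a polynomial of degree at most 2. *)
Definition isotropic q := exists e : R, forall x,
  \sum_(A <- rots R) q (act A x) = 12 * q (origin R) + e * sqnorm x.

(** The changes of sign cancel the linear and the mixed monomials. The square of a coordinate
    becomes each of the three squares 4 times over the orbit, whence [e = 4]. *)
Lemma isotropic_monomial3 i j k : (i + j + k <= 2)%N ->
  isotropic (monomial3 i j k).
Proof.
have S q u v w : \sum_(A <- rots R) q (act A (u, v, w)) =
   q (u, v, w) + q (- u, v, - w) + q (u, - v, - w) + q (- u, - v, w)
   + q (v, w, u) + q (- v, w, - u) + q (v, - w, - u) + q (- v, - w, u)
   + q (w, u, v) + q (- w, u, - v) + q (w, - u, - v) + q (- w, - u, v).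
  rewrite !big_cons big_nil addr0 !act_mat.
  rewrite !(mul0r, mul1r, mulN1r, addr0, add0r).
  by ring.
case: i j k => [|[|[|i]]] [|[|[|j]]] [|[|[|k]]] //= _.
- exists 0 => -[[u v] w]; rewrite S /monomial3 /= sqnorm3; ring.
- exists 0 => -[[u v] w]; rewrite S /monomial3 /= sqnorm3; ring.
- exists 4 => -[[u v] w]; rewrite S /monomial3 /= sqnorm3; ring.
- exists 0 => -[[u v] w]; rewrite S /monomial3 /= sqnorm3; ring.
- exists 0 => -[[u v] w]; rewrite S /monomial3 /= sqnorm3; ring.
- exists 4 => -[[u v] w]; rewrite S /monomial3 /= sqnorm3; ring.
- exists 0 => -[[u v] w]; rewrite S /monomial3 /= sqnorm3; ring.
- exists 0 => -[[u v] w]; rewrite S /monomial3 /= sqnorm3; ring.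
- exists 0 => -[[u v] w]; rewrite S /monomial3 /= sqnorm3; ring.
- exists 4 => -[[u v] w]; rewrite S /monomial3 /= sqnorm3; ring.
Qed.

Lemma isotropic_meval (q : mpoly.mpoly 3 R) : (mpoly.msize q <= 3)%N ->
  isotropic (fun x => mpoly.meval (coordinate x) q).
Proof.
move=> q3.
have sub : {in mpoly.msupp q, forall m : mpoly.multinom 3, exists e, forall x,
    \sum_(A <- rots R) monomialm m (act A x) =
    12 * monomialm m (origin R) + e * sqnorm x}.
  by move=> m /(degree3 q3)/isotropic_monomial3.
suff [e eE] : exists e, forall x,
    \sum_(A <- rots R) \sum_(m <- mpoly.msupp q)
      mpoly.mcoeff m q * monomialm m (act A x) =
    12 * (\sum_(m <- mpoly.msupp q)
      mpoly.mcoeff m q * monomialm m (origin R)) + e * sqnorm x.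
  exists e => x; rewrite meval3 -eE; apply: eq_bigr => A _; exact: meval3.
elim: (mpoly.msupp q : seq _) sub => [|m s IH] sub.
  by exists 0 => x; rewrite !big_nil big1 => [|A _]; rewrite ?big_nil//; ring.
have [|e eE] := IH; first by move=> m' m's; apply: sub; rewrite inE m's orbT.
have [|e' e'E] := sub m; first by rewrite inE eqxx.
exists (mpoly.mcoeff m q * e' + e) => x.
under eq_bigr do rewrite big_cons.
rewrite big_split/= eE -big_distrr/= e'E big_cons; ring.
Qed.

End Moments.

(** * Measure-preserving maps *)

Section MeasurePreserving.
Local Open Scope ereal_scope.

Definition measure_preserving d (T : measurableType d) (R : realType)
    (mu : set T -> \bar R) (phi : T -> T) :=
  measurable_fun [set: T] phi /\
  forall A, measurable A -> mu (phi @^-1` A) = mu A.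

Lemma measure_preserving_id d (T : measurableType d) (R : realType)
  (mu : set T -> \bar R) : measure_preserving mu id.
Proof. by split => //; exact: measurable_id. Qed.

Lemma measure_preserving_comp d (T : measurableType d) (R : realType)
    (mu : set T -> \bar R) (phi psi : T -> T) :
  measure_preserving mu phi -> measure_preserving mu psi ->
  measure_preserving mu (phi \o psi).
Proof.
move=> [mphi phiE] [mpsi psiE]; split; first exact: measurableT_comp.
move=> A mA; rewrite comp_preimage psiE ?phiE//.
by rewrite -[X in measurable X]setTI; exact: mphi.
Qed.

Lemma measure_preserving_cancel d (T : measurableType d) (R : realType)
    (mu : set T -> \bar R) (phi psi : T -> T) :
  cancel phi psi -> measurable_fun setT psi ->
  measure_preserving mu phi -> measure_preserving mu psi.
Proof.
move=> phiK mpsi [mphi phiE]; split => // A mA.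
rewrite -phiE; last by rewrite -[X in measurable X]setTI; exact: mpsi.
by rewrite -comp_preimage; congr (mu _); apply/seteqP; split=> x /=; rewrite phiK.
Qed.

(** By uniqueness of the product measure it is enough to compare on rectangles. *)
Lemma measure_preserving_pair d1 d2 (T1 : measurableType d1)
    (T2 : measurableType d2) (R : realType)
    (m1 : {sigma_finite_measure set T1 -> \bar R})
    (m2 : {sigma_finite_measure set T2 -> \bar R})
    (phi : T1 -> T1) (psi : T2 -> T2) :
  measure_preserving m1 phi -> measure_preserving m2 psi ->
  measure_preserving (m1 \x m2) (fun x => (phi x.1, psi x.2)).
Proof.
move=> [mphi phiE] [mpsi psiE].
have mphipsi : measurable_fun [set: T1 * T2] (fun x => (phi x.1, psi x.2)).
  by apply: measurable_fun_pair; exact: measurableT_comp.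
split=> // A mA; apply/esym.
pose p : {mfun _ >-> _} := mfun_Sub (mem_set mphipsi).
rewrite (@product_measure_unique _ _ _ _ _ m1 m2 (pushforward (m1 \x m2) p))//.
move=> X Y mX mY; rewrite /= /pushforward.
rewrite (_ : _ @^-1` _ = (phi @^-1` X) `*` (psi @^-1` Y)) ?product_measure1E//.
- by congr (_ * _); [exact: phiE|exact: psiE].
- by rewrite -[X in measurable X]setTI; exact: mphi.
- by rewrite -[X in measurable X]setTI; exact: mpsi.
Qed.

Lemma preimage_opp_itvoc (R : realType) (a b : R) :
  (-%R @^-1` `]a, b]%classic = `[- b, - a[%classic)%R.
Proof.
by apply/seteqP; split=> x /=; rewrite !in_itv /= ltrNr lerNl andbC.
Qed.

(** By uniqueness of Lebesgue measure it is enough to compare on half-open intervals; reflection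
    moves the closed end to the other side but keeps the length. *)
Lemma lebesgue_measure_opp (R : realType) :
  measure_preserving (@lebesgue_measure R) (-%R : measurableTypeR R -> _).
Proof.
have mN : @measurable_fun _ _ (measurableTypeR R) (measurableTypeR R) setT -%R.
  exact: oppr_measurable.
split => // A mA; apply/esym.
apply: (@lebesgue_measure_unique R (pushforward (@lebesgue_measure R)
  (-%R : measurableTypeR R -> measurableTypeR R))) => //.
move=> X /ocitvP[->|[[a b] /= ab ->]].
  by rewrite !measure0.
rewrite /= /pushforward /=.
rewrite preimage_opp_itvoc.
rewrite !lebesgue_measure_itv /= !lte_fin ltrN2.
by case: ifP => // _; rewrite -!EFinB; congr EFin; ring.
Qed.

End MeasurePreserving.

(** * Sigma-finiteness of products *)

Section ProductSigmaFinite.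
Local Open Scope ereal_scope.
Context d1 d2 (T1 : measurableType d1) (T2 : measurableType d2) (R : realType).
Variable m1 : {sigma_finite_measure set T1 -> \bar R}.
Variable m2 : {sigma_finite_measure set T2 -> \bar R}.

Lemma sigma_finite_product : sigma_finite setT (m1 \x m2).
Proof.
have /sigma_finiteP[F [TF ndF Foo]] := sigma_finiteT m1.
have /sigma_finiteP[G [TG ndG Goo]] := sigma_finiteT m2.
exists (fun n => F n `*` G n).
  apply/seteqP; split=> [[x y] _|//].
  have [m _ Fx] : (\bigcup_n F n) x by rewrite -TF.
  have [n _ Gy] : (\bigcup_n G n) y by rewrite -TG.
  exists (maxn m n) => //; split; [move: Fx|move: Gy]; apply/subsetPset.
    exact/ndF/leq_maxl.
  exact/ndG/leq_maxr.
move=> k; have [mF Fk] := Foo k; have [mG Gk] := Goo k.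
split; first exact: measurableX.
by rewrite product_measure1E// lte_mul_pinfty// ge0_fin_numE.
Qed.

(* The library attaches this structure to products of subprobabilities only. *)
Definition product_sigma_finite :
    {sigma_finite_measure set (T1 * T2)%type -> \bar R} :=
  HB.pack (m1 \x m2)
    (Measure_isSigmaFinite.Build _ _ _ (m1 \x m2) sigma_finite_product).

End ProductSigmaFinite.

(** * Invariance of Lebesgue measure under the rotations *)

Section LebesgueRotation.
Variable R : realType.
Local Notation mR := (measurableTypeR R).
Local Notation la := (@lebesgue_measure R).
Local Open Scope ereal_scope.

Definition borel3 := ((la \x la) \x la).

(** Both sides equal the iterated integral over [x], then [y], then [z] of [h (y, z, x)]: on the
    left Tonelli integrates the last factor first, on the right it integrates the first pair
    first. *)
Lemma integral_cycle d (T : measurableType d)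
    (m : {sigma_finite_measure set T -> \bar R})
    (h : T * T * T -> \bar R) :
  measurable_fun setT h -> (forall x, 0 <= h x) ->
  \int[(m \x m) \x m]_x h (x.1.2, x.2, x.1.1) = \int[(m \x m) \x m]_x h x.
Proof.
move=> mh h0.
pose g (x : T * T * T) := h (x.1.2, x.2, x.1.1).
have mg : measurable_fun setT g.
  apply: measurableT_comp => //; apply: measurable_fun_pair.
    by apply: measurable_fun_pair => //; exact: measurableT_comp.
  exact: measurableT_comp.
have g0 x : 0 <= g x by exact: h0.
pose mm := product_sigma_finite m m.
transitivity (\int[m \x m]_x fubini_F m g x).
  exact: (@fubini_tonelli1 _ _ (T * T)%type T R mm m g mg g0).
transitivity (\int[m]_x \int[m]_y fubini_F m g (x, y)).
  apply: fubini_tonelli1; first exact: measurable_fun_fubini_tonelli_F.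
  by move=> x; apply: integral_ge0.
transitivity (\int[m]_x fubini_G (m \x m) h x); last first.
  exact/esym/(@fubini_tonelli2 _ _ (T * T)%type T R mm m h mh h0).
apply: eq_integral => x _; apply/esym.
apply: (fubini_tonelli1 (fun y => h (y, x))) => //.
exact: measurable_fun_pair1.
Qed.

Lemma measure_preserving_cycle d (T : measurableType d)
    (m : {sigma_finite_measure set T -> \bar R}) :
  measure_preserving ((m \x m) \x m) (fun x => (x.1.2, x.2, x.1.1)).
Proof.
have mphi : measurable_fun setT (fun x : T * T * T => (x.1.2, x.2, x.1.1)).
  apply: measurable_fun_pair; last exact: measurableT_comp.
  by apply: measurable_fun_pair => //; exact: measurableT_comp.
split=> // A mA.
have mA' : measurable ((fun x : T * T * T => (x.1.2, x.2, x.1.1)) @^-1` A).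
  by rewrite -[X in measurable X]setTI; exact: mphi.
have ind B : measurable B ->
    \int[(m \x m) \x m]_x (\1_B x)%:E = ((m \x m) \x m) B.
  by move=> mB; rewrite integral_indic// setIT.
rewrite -(ind _ mA') -(ind _ mA).
apply: etrans (integral_cycle m (h := EFin \o \1_A) _ _).
- by apply: eq_integral => x _; rewrite /= !indicE.
- by apply/measurable_EFinP; exact: measurable_indic.
- by move=> x; rewrite /= lee_fin.
Qed.

Lemma measurable_act (A : 'M[R]_3) : measurable_fun [set: mR * mR * mR] (act A).
Proof.
rewrite [A]matE.
move: (A _ _) (A _ _) (A _ _) (A _ _) (A _ _) (A _ _) (A _ _) (A _ _) (A _ _).
move=> i h g f e d' c b a.
apply: (eq_measurable_fun (fun x : mR * mR * mR =>
  (a * x.1.1 + b * x.1.2 + c * x.2, d' * x.1.1 + e * x.1.2 + f * x.2,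
   g * x.1.1 + h * x.1.2 + i * x.2)%R : mR * mR * mR)).
  by move=> [[u v] w] _; rewrite act_mat.
have m3 (p q r : R) : measurable_fun [set: mR * mR * mR]
    (fun x => p * x.1.1 + q * x.1.2 + r * x.2 : mR)%R.
  by apply: measurable_funD => //; [apply: measurable_funD => //|];
    apply: measurable_funM => //; exact: measurableT_comp.
by apply: measurable_fun_pair; [apply: measurable_fun_pair|]; exact: m3.
Qed.

Lemma borel3_R1 : measure_preserving borel3 (act (R1 R)).
Proof.
have [mc cE] := measure_preserving_cycle la.
split; first exact: measurable_act.
move=> A mA; rewrite -[RHS]cE//; congr (borel3 _); apply/seteqP.
by split=> -[[u v] w] /=; rewrite R1E act_mat !(mul0r, mul1r, addr0, add0r).
Qed.

Lemma borel3_R2 : measure_preserving borel3 (act (R2 R)).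
Proof.
have N := lebesgue_measure_opp R.
have [_ cE] := measure_preserving_pair (m1 := product_sigma_finite la la) (m2 := la)
  (measure_preserving_pair N (measure_preserving_id la)) N.
split; first exact: measurable_act.
move=> A mA; rewrite -[RHS]cE//; congr (borel3 _); apply/seteqP.
by split=> -[[u v] w] /=; rewrite R2E act_mat !(mul0r, mul1r, addr0, add0r, mulN1r).
Qed.

(** The invertible matrices whose action preserves the measure form a subgroup, so the two
    generators suffice. *)
Lemma borel3_rotation A : rotation_group R A -> measure_preserving borel3 (act A).
Proof.
rewrite rotation_group_generated => AG.
suff : [set A | A \in unitmx /\ measure_preserving borel3 (act A)] A by case.
apply: AG; split.
- split=> [B []//||B C [uB pB] [uC pC]|B [uB pB]].
  + split; first exact: unitmx1.
    rewrite (_ : act 1%:M = id); first exact: measure_preserving_id.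
    by apply/funext => x; rewrite act1.
  + split; first by rewrite unitmx_mul uB.
    rewrite (_ : act (B *m C) = act B \o act C); last exact/funext/act_mul.
    exact: measure_preserving_comp.
  + split; first by rewrite unitmx_inv.
    apply: measure_preserving_cancel pB; last exact: measurable_act.
    by move=> x; rewrite -act_mul mulVmx// act1.
- move=> _ [->|->]; split.
  + exact: rotation_unit (rotation_group_R1 R).1.
  + exact: borel3_R1.
  + exact: rotation_unit (rotation_group_R2 R).1.
  + exact: borel3_R2.
Qed.

End LebesgueRotation.

Arguments borel3 : clear implicits.

(** * The volume of the tetrahedron *)

Section TetrahedronVolume.
Variable R : realType.
Local Notation mR := (measurableTypeR R).
Local Notation la := (@lebesgue_measure R).

Lemma integral_deriv_poly (p : {poly R}) (a b : R) : a < b ->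
  (\int[la]_(x in `[a, b]) (p^`().[x])%:E = (p.[b] - p.[a])%:E)%E.
Proof.
move=> ab; rewrite (@continuous_FTC2 _ (horner p^`()) (horner p))//.
- by apply: continuous_subspaceT; exact: continuous_horner.
- split=> [x _||]; first exact: derivable_horner.
    by apply: cvg_at_right_filter; exact: continuous_horner.
  by apply: cvg_at_left_filter; exact: continuous_horner.
- by move=> x _; rewrite -derivE.
Qed.

(** The product measure is defined by sections in the other direction; Tonelli for an indicator
    exchanges the two. *)
Lemma product_measure_ysection d1 d2 (T1 : measurableType d1)
    (T2 : measurableType d2) (m1 : {sigma_finite_measure set T1 -> \bar R})
    (m2 : {sigma_finite_measure set T2 -> \bar R}) (A : set (T1 * T2)) :
  measurable A -> ((m1 \x m2) A = \int[m2]_y m1 (ysection A y))%E.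
Proof.
move=> mA; have := indic_fubini_tonelli m1 m2 mA.
by rewrite (indic_fubini_tonelli_FE _ mA) (indic_fubini_tonelli_GE _ mA).
Qed.

(* Vertical lines meet this square pyramid and the tetrahedron in segments of the
   same length, hence both have the same volume by Cavalieri's principle. *)
Definition pyramid : set (mR * mR * mR) :=
  [set x | 0 <= x.2 /\ (`|x.1.1| <= 1 - x.2 / 2 /\ `|x.1.2| <= 1 - x.2 / 2)].

Lemma measurable_affine (c p q r : R) : measurable_fun [set: mR * mR * mR]
  (fun x => c + p * x.1.1 + q * x.1.2 + r * x.2 : mR).
Proof.
apply: measurable_funD; [apply: measurable_funD; [apply: measurable_funD|]|] => //;
  by apply: measurable_funM => //; exact: measurableT_comp.
Qed.

Lemma measurable_halfspace (c p q r : R) : measurable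
  [set x : mR * mR * mR | 0 <= c + p * x.1.1 + q * x.1.2 + r * x.2].
Proof.
have := measurable_affine c p q r measurableT (measurable_itv `[0, +oo[).
rewrite setTI; congr measurable.
by apply/seteqP; split=> x /=; rewrite in_itv /= andbT.
Qed.

Lemma measurable_tetrahedron : measurable (tetrahedron R : set (mR * mR * mR)).
Proof.
rewrite (_ : tetrahedron R =
  [set x | 0 <= 1 + 1 * x.1.1 + 1 * x.1.2 + 1 * x.2] `&`
  [set x | 0 <= 1 + (-1) * x.1.1 + (-1) * x.1.2 + 1 * x.2] `&`
  [set x | 0 <= 1 + (-1) * x.1.1 + 1 * x.1.2 + (-1) * x.2] `&`
  [set x | 0 <= 1 + 1 * x.1.1 + (-1) * x.1.2 + (-1) * x.2]).
  by do ?apply: measurableI; exact: measurable_halfspace.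
apply/seteqP; split=> [[[u v] w] /tetrahedron3[h0 h1 h2 h3]|[[u v] w] /=].
  do !split; move=> /=; lra.
move=> [[[h0 h1] h2] h3]; apply/tetrahedron3; split; lra.
Qed.

Lemma measurable_pyramid : measurable pyramid.
Proof.
rewrite (_ : pyramid =
  [set x | 0 <= 0 + 0 * x.1.1 + 0 * x.1.2 + 1 * x.2] `&`
  ([set x | 0 <= 1 + 1 * x.1.1 + 0 * x.1.2 + (- 2^-1) * x.2] `&`
  [set x | 0 <= 1 + (-1) * x.1.1 + 0 * x.1.2 + (- 2^-1) * x.2] `&`
  ([set x | 0 <= 1 + 0 * x.1.1 + 1 * x.1.2 + (- 2^-1) * x.2] `&`
  [set x | 0 <= 1 + 0 * x.1.1 + (-1) * x.1.2 + (- 2^-1) * x.2]))).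
  by apply: measurableI; [exact: measurable_halfspace|apply: measurableI;
     apply: measurableI; exact: measurable_halfspace].
apply/seteqP; split=> [[[u v] w]|[[u v] w]] /=; rewrite /pyramid /= !ler_norml.
  move=> [h0 [/andP[h1 h2] /andP[h3 h4]]]; do !split; lra.
move=> [h0 [[h1 h2] [h3 h4]]]; split; [lra|split; apply/andP; split; lra].
Qed.

Lemma xsection_tetrahedron_pyramid (x : mR * mR) :
  la (xsection (tetrahedron R) x) = la (xsection pyramid x).
Proof.
case: x => u v.
rewrite (_ : xsection (tetrahedron R) _ =
  `[Num.max (- 1 - u - v) (u + v - 1),
    Num.min (1 + u - v) (1 - u + v)]%classic); last first.
  rewrite xsectionE; apply/seteqP; split=> w /=; rewrite in_itv /= ge_max le_min.
    by move=> /tetrahedron3[h0 h1 h2 h3]; apply/andP; split; apply/andP; split; lra.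
  move=> /andP[/andP[h0 h1] /andP[h2 h3]]; apply/tetrahedron3; split; lra.
rewrite (_ : xsection pyramid _ =
  `[0, 2 - 2 * Num.max `|u| `|v| ]%classic); last first.
  rewrite xsectionE; apply/seteqP; split=> w /=; rewrite in_itv /= /pyramid /=.
    move=> [-> h] /=.
    have : Num.max `|u| `|v| <= 1 - w / 2 by rewrite ge_max; apply/andP.
    lra.
  move=> /andP[-> h]; have : Num.max `|u| `|v| <= 1 - w / 2 by lra.
  by rewrite ge_max => /andP.
rewrite !lebesgue_measure_itv /= !lte_fin.
(* The ends of the segment are [1 - |u - v|] and [|u + v| - 1], and
   [|u + v| + |u - v| = 2 max(|u|, |v|)]. Where the difference is not positive, both lengths are
   0. *)
have E : Num.min (1 + u - v) (1 - u + v) - Num.max (- 1 - u - v) (u + v - 1) =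
  2 - 2 * Num.max `|u| `|v|.
  have [u0|u0] := leP 0 u; have [v0|v0] := leP 0 v;
    rewrite ?(ger0_norm u0) ?(ltr0_norm u0) ?(ger0_norm v0) ?(ltr0_norm v0);
    rewrite /Num.max /Num.min;
    by do ![case: ifPn; rewrite -?leNgt => ?]; lra.
by rewrite -!EFinB E subr0 -subr_gt0 E.
Qed.

Lemma borel3_tetrahedron :
  borel3 R (tetrahedron R : set (mR * mR * mR)) = (8 / 3)%:E.
Proof.
transitivity (borel3 R pyramid).
  by apply: eq_integral => x _; exact: xsection_tetrahedron_pyramid.
rewrite [LHS](product_measure_ysection (product_sigma_finite la la) la
  measurable_pyramid).
(* The slice of the pyramid at height [w] is a square of side [2 - w]; [p] is an antiderivative of
   its area. *)
pose p : {poly R} := (3^-1)%:P * ('X - 2%:P) ^+ 3.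
have pE : p^`() = ('X - 2%:P) ^+ 2.
  rewrite /p derivM derivC mul0r add0r deriv_exp derivXsubC mul1r.
  rewrite mulrnAr -mulrnAl -polyCMn (_ : 3^-1 *+ 3 = 1) ?mul1r//.
  by field.
transitivity (\int[la]_(w in `[0%R : R, 2%R : R]) (p^`().[w])%:E)%E; last first.
  have pv x : p.[x] = 3^-1 * (x - 2) ^+ 3.
    by rewrite hornerM hornerC horner_exp hornerXsubC.
  by rewrite integral_deriv_poly// !pv; congr EFin; field.
rewrite [RHS]integral_mkcond; apply: eq_integral => w _.
rewrite /= patchE mem_setE pE; case: ifPn => [|w02].
  rewrite in_itv/= => /andP[w0 w2].
  rewrite (_ : ysection pyramid w =
    `[w / 2 - 1, 1 - w / 2] `*` `[w / 2 - 1, 1 - w / 2]); last first.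
    rewrite ysectionE; apply/seteqP; split=> -[u v] /=.
      by rewrite /pyramid /= !in_itv/= !ler_norml opprB => -[].
    by rewrite /pyramid /= !in_itv/= !ler_norml opprB => -[].
  set I := [set` _]; transitivity (la I * la I)%E.
    by apply: product_measure1E; exact: measurable_itv.
  rewrite horner_exp hornerXsubC !lebesgue_measure_itv /= !lte_fin.
  (* The formula for the length of an interval separates off the apex [w = 2], where the slice is a
     point. *)
  case: ifPn => [h|]; first by apply: (congr1 EFin); rewrite /=; field.
  rewrite -leNgt => h'; have -> : w = 2 by lra.
  by rewrite mul0e subrr expr0n.
rewrite (_ : ysection _ _ = set0) ?measure0//.
rewrite ysectionE; apply/seteqP; split=> // -[u v] /=.
rewrite /pyramid /= => -[w0 [/(le_trans (normr_ge0 _)) h _]].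
by move: w02; rewrite in_itv /= w0 /= => /negP; apply; lra.
Qed.

End TetrahedronVolume.

Arguments measurable_tetrahedron : clear implicits.
Arguments borel3_tetrahedron : clear implicits.

(** * Integration against a measure with a density *)

Section Density.
Local Open Scope ereal_scope.
Context d (T : measurableType d) (R : realType).
Variables (nu : {finite_measure set T -> \bar R})
          (mu : {sigma_finite_measure set T -> \bar R}) (w : T -> \bar R).
Hypotheses (mw : measurable_fun [set: T] w) (w0 : forall x, 0 <= w x).
Hypothesis nuE : forall A, measurable A -> nu A = \int[mu]_(x in A) w x.

Lemma density_dominates : nu `<< mu.
Proof.
apply/null_content_dominatesP => A mA A0.
rewrite nuE// (ge0_negligible_integral mA)//; last exact: measurable_funTS.
by rewrite setDv integral_set0.
Qed.

(** Both functions have integral [nu A] over every measurable [A]. *)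
Lemma density_Radon_Nikodym :
  ae_eq mu [set: T] (Radon_Nikodym_SigmaFinite.f nu mu) w.
Proof.
apply: integral_ae_eq => //.
  exact: Radon_Nikodym_SigmaFinite.f_integrable density_dominates.
move=> A _ mA.
by rewrite -nuE// -Radon_Nikodym_SigmaFinite.f_integral//; exact: density_dominates.
Qed.

Lemma ge0_integral_density (f : T -> \bar R) :
  measurable_fun [set: T] f -> (forall x, 0 <= f x) ->
  \int[nu]_x f x = \int[mu]_x (f x * w x).
Proof.
move=> mf f0; have numu := density_dominates.
rewrite -(Radon_Nikodym_SigmaFinite.change_of_variables numu)//.
apply: ae_eq_integral => //.
- apply: emeasurable_funM => //.
  exact: measurable_int (Radon_Nikodym_SigmaFinite.f_integrable numu).
- exact: emeasurable_funM.
- exact/ae_eqe_mul2l/density_Radon_Nikodym.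
Qed.

(** Integrability is required of the product with [w], because the intended [f] contains the
    unbounded factor [w1], which [w] compensates. *)
Lemma integral_density (f : T -> \bar R) :
  measurable_fun [set: T] f -> mu.-integrable [set: T] (f \* w) ->
  nu.-integrable [set: T] f /\ \int[nu]_x f x = \int[mu]_x (f x * w x).
Proof.
move=> mf /integrableP[mfw fwoo]; have numu := density_dominates.
have intf : nu.-integrable [set: T] f.
  apply/integrableP; split => //; rewrite ge0_integral_density//.
    apply: le_lt_trans fwoo; rewrite le_eqVlt; apply/orP; left; apply/eqP.
    by apply: eq_integral => x _ /=; rewrite abseM (gee0_abs (w0 x)).
  exact: measurableT_comp.
split => //; rewrite -(Radon_Nikodym_change_of_variables numu)//.
apply: ae_eq_integral => //.
- by apply: emeasurable_funM => //.
- apply: ae_eqe_mul2l; apply: ae_eq_trans density_Radon_Nikodym.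
  exact/ae_eq_sym/ae_eq_Radon_Nikodym_SigmaFinite.
Qed.

End Density.

(** * The weight [w1] against the law of the random point *)

Section QuadratureExpectation.
Variable R : realType.
Local Notation mR := (measurableTypeR R).
Local Notation space := (mR * mR * mR)%type.
Local Notation la := (@lebesgue_measure R).
Local Notation mu3 := (product_sigma_finite (product_sigma_finite la la) la).
Local Notation tet := (tetrahedron R : set space).

Lemma measurable_inv : measurable_fun [set: mR] (GRing.inv : mR -> mR).
Proof.
have m0 : measurable ([set 0] : set mR) by exact: measurable_set1.
rewrite -(setvU ([set 0] : set mR)).
apply/measurable_funU => //; first exact: measurableC.
split; last exact: measurable_fun_set1.
apply: open_continuous_measurable_fun; first exact/closed_openC/closed_eq.
by apply/in_setP => x /= /eqP x0; exact: inv_continuous.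
Qed.

Lemma measurable_sqnorm : measurable_fun [set: space] (@sqnorm R : space -> mR).
Proof.
apply: (eq_measurable_fun
  (fun x : space => x.1.1 ^+ 2 + x.1.2 ^+ 2 + x.2 ^+ 2 : mR)).
  by move=> [[u v] w] _; rewrite sqnorm3.
by apply: measurable_funD; [apply: measurable_funD|];
  apply: measurable_funX => //; exact: measurableT_comp.
Qed.

Lemma measurable_density : measurable_fun [set: space] (@density R : space -> mR).
Proof. by apply: measurable_funM => //; exact: measurable_sqnorm. Qed.

Lemma measurable_w1 : measurable_fun [set: space] (@w1 R : space -> mR).
Proof.
apply: measurable_funM => //; apply: measurableT_comp; first exact: measurable_inv.
by apply: measurable_funM => //; exact: measurable_sqnorm.
Qed.

Lemma sqnorm_ge0 (x : space) : 0 <= sqnorm x.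
Proof. by apply: sumr_ge0 => i _; exact: sqr_ge0. Qed.

Lemma sqnorm_eq0 (x : space) : sqnorm x = 0 -> x = origin R.
Proof.
case: x => [[u v] w]; rewrite sqnorm3 => uvw.
have := sqr_ge0 u; have := sqr_ge0 v; have := sqr_ge0 w => w2 v2 u2.
have /eqP : u ^+ 2 = 0 by lra.
have /eqP : v ^+ 2 = 0 by lra.
have /eqP : w ^+ 2 = 0 by lra.
by rewrite !sqrf_eq0 => /eqP -> /eqP -> /eqP ->.
Qed.

(** At the origin both factors are 0, hence the exception. *)
Lemma w1_density (x : space) : x <> origin R -> w1 x * density x = 12^-1.
Proof.
move=> x0; have s0 : sqnorm x != 0 by apply/eqP => /sqnorm_eq0.
by rewrite /w1 /density; field.
Qed.

Lemma originE : [set origin R] = ([set 0] `*` [set 0]) `*` [set 0].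
Proof. by apply/seteqP; split=> [_ -> //|[[u v] w] [[/= -> ->] ->]//]. Qed.

Lemma measurable_origin : measurable ([set origin R] : set space).
Proof.
have m0 : measurable ([set 0] : set mR) by exact: measurable_set1.
by rewrite originE; apply: measurableX => //; exact: measurableX.
Qed.

Lemma borel3_origin : mu3 [set origin R] = 0%E.
Proof.
have m0 : measurable ([set 0] : set mR) by exact: measurable_set1.
rewrite originE [LHS]product_measure1E//; last exact: measurableX.
by rewrite [X in (_ * X)%E]lebesgue_measure_set1 mule0.
Qed.

Section Law.
Variable nu : {finite_measure set space -> \bar R}.
Hypothesis nuE : forall A, measurable A ->
  nu A = (\int[mu3]_(y in A `&` tet) (density y)%:E)%E.

Lemma law_null (A : set space) : measurable A -> mu3 A = 0%E -> nu A = 0%E.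
Proof.
move=> mA A0; rewrite nuE//; apply: null_set_integral.
- by apply: measurableI => //; exact: measurable_tetrahedron R.
- by apply/measurable_EFinP; apply: measurable_funTS; exact: measurable_density.
- apply/eqP; rewrite -measure_le0 -A0; apply: le_measure; rewrite ?inE//.
  by apply: measurableI => //; exact: measurable_tetrahedron R.
Qed.

Lemma integral_w1 (k : space -> R) :
  measurable_fun [set: space] k -> mu3.-integrable tet (EFin \o k) ->
  nu.-integrable [set: space] (fun y => (w1 y * k y)%:E) /\
  (\int[nu]_y (w1 y * k y)%:E = 12^-1%:E * \int[mu3]_(y in tet) (k y)%:E)%E.
Proof.
move=> mk ik; have mT := measurable_tetrahedron R.
pose w := (EFin \o @density R : space -> \bar R) \_ tet.
have mw : measurable_fun [set: space] w.
  have [+ _] := measurable_restrictT (EFin \o @density R : space -> \bar R) mT.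
  apply; apply/measurable_EFinP; apply: measurable_funTS.
  exact: measurable_density.
have w0 y : (0 <= w y)%E.
  rewrite /w patchE; case: ifPn => // _.
  by rewrite lee_fin mulr_ge0// ?divr_ge0// sqnorm_ge0.
have nuw A : measurable A -> (nu A = \int[mu3]_(y in A) w y)%E.
  by move=> mA; rewrite nuE// integral_mkcondr.
have mwk : measurable_fun [set: space] (fun y => (w1 y * k y)%:E).
  by apply/measurable_EFinP; apply: measurable_funM => //; exact: measurable_w1.
pose k' := (fun y => 12^-1%:E * (k y)%:E)%E \_ tet.
have ik' : mu3.-integrable [set: space] k'.
  by apply/(integrable_mkcond _ mT)/integrableZl.
have kk' y : y <> origin R -> ((w1 y * k y)%:E * w y = k' y)%E.
  move=> y0; rewrite /w /k' !patchE; case: ifPn => _; last by rewrite mule0.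
  by rewrite -!EFinM mulrAC w1_density.
have ae : ae_eq mu3 [set: space] (fun y => (w1 y * k y)%:E * w y)%E k'.
  exists [set origin R]; split.
  - exact: measurable_origin.
  - exact: borel3_origin.
  - by move=> y /= h; apply: contrapT => y0; apply: h => _; exact: kk'.
have [|iw iwE] := integral_density mw w0 nuw mwk; last first.
  split => //; rewrite iwE (ae_eq_integral k')//.
  - by rewrite -integral_mkcond integralZl.
  - exact: emeasurable_funM.
  - exact: measurable_int ik'.
(* The domination by [k'] holds everywhere: it is an equality off the origin, and at the origin the
   density vanishes. *)
apply: le_integrable ik' => //; first exact: emeasurable_funM.
move=> y _ /=; have [->|/eqP y0] := eqVneq y (origin R); last by rewrite kk'.
rewrite /w patchE; case: ifPn => _; last by rewrite mule0 abse0.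
have d0 : density (origin R) = 0.
  by rewrite /density sqnorm3 !expr0n /= !addr0 mulr0.
by rewrite /= d0 mulr0 normr0 abse_ge0.
Qed.

End Law.

End QuadratureExpectation.

Arguments measurable_w1 : clear implicits.
Arguments borel3_origin : clear implicits.

(** * Expectation of the rule for Borel functions *)

Lemma integral_measure_preserving d (T : measurableType d) (R : realType)
    (mu : {measure set T -> \bar R}) (phi : T -> T) (D : set T)
    (f : T -> \bar R) :
  measure_preserving mu phi -> measurable D -> phi @^-1` D = D ->
  measurable_fun [set: T] f -> mu.-integrable D f ->
  mu.-integrable D (f \o phi) /\
  (\int[mu]_(x in D) f (phi x) = \int[mu]_(x in D) f x)%E.
Proof.
move=> [mphi phiE] mD phiD mf intf.
have intE (g : T -> \bar R) :
    measurable_fun D g -> (forall x, D x -> (0 <= g x)%E) ->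
    (\int[mu]_(x in D) g (phi x) = \int[mu]_(x in D) g x)%E.
  move=> mg g0; rewrite -[in LHS]phiD -(ge0_integral_pushforward mphi)//.
    by apply: eq_measure_integral => // A mA _; exact: phiE.
  by move=> x /[!inE] /g0.
have mfphi : measurable_fun D (f \o phi).
  by apply: measurable_funTS; exact: measurableT_comp.
have mfD : measurable_fun D f by exact: measurable_funTS.
split; last first.
  rewrite [LHS]integralE [RHS]integralE; congr (_ - _)%E.
    rewrite -[RHS]intE//; first by under eq_integral do rewrite funepos_comp.
    exact: measurable_funepos.
  rewrite -[RHS]intE//; first by under eq_integral do rewrite funeneg_comp.
  exact: measurable_funeneg.
have /integrableP[_ foo] := intf.
apply/integrableP; split => //=.
rewrite (intE (abse \o f))//; first exact: measurableT_comp.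
by move=> x _; exact: abse_ge0.
Qed.

Section Unbiased.
Variable R : realType.
Local Notation mR := (measurableTypeR R).
Local Notation space := (mR * mR * mR)%type.
Local Notation la := (@lebesgue_measure R).
Local Notation mu3 := (product_sigma_finite (product_sigma_finite la la) la).
Local Notation tet := (tetrahedron R : set space).

Lemma preimage_act_tetrahedron A :
  rotation_group R A -> act A @^-1` tetrahedron R = tetrahedron R.
Proof.
move=> [rA TA]; apply/seteqP; split=> [x|x Tx]; last first.
  by rewrite /= -TA; exists x.
move=> TAx; have [y Ty Axy] : (act A @` tetrahedron R) (act A x) by rewrite TA.
suff <- : y = x by [].
have uA := rotation_unit rA.
by rewrite -[y]act1 -(mulVmx uA) act_mul Axy -act_mul mulVmx// act1.
Qed.

Lemma integral_act A (g : space -> R) : rotation_group R A ->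
  measurable_fun [set: space] g -> mu3.-integrable tet (EFin \o g) ->
  mu3.-integrable tet (fun y => (g (act A y))%:E) /\
  (\int[mu3]_(y in tet) (g (act A y))%:E = \int[mu3]_(y in tet) (g y)%:E)%E.
Proof.
move=> GA mg ig; apply: (integral_measure_preserving (f := EFin \o g)) => //.
- exact: borel3_rotation.
- exact: measurable_tetrahedron.
- exact: preimage_act_tetrahedron.
- exact/measurable_EFinP.
Qed.

Lemma borel3_tetrahedron_lty : (mu3 tet < +oo)%E.
Proof. by rewrite [X in (X < _)%E](borel3_tetrahedron R) ltry. Qed.

(** The rule with the value at the origin as a separate parameter, so that [g] may be a Borel
    version of [f] while [c] remains the true [f(0)]. *)
Definition quadrature (g : space -> R) (c : R) (y : space) : R :=
  w1 y * (\sum_(A <- rots R) g (act A y) - 12 * c) + 8 / 3 * c.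

(** The result does not depend on [c], whose total coefficient is
    [- 12 * (8 / 3) / 12 + 8 / 3 = 0]. *)
Lemma integral_quadrature (nu : {finite_measure set space -> \bar R})
    (g : space -> R) (c : R) :
  (forall A, measurable A ->
    nu A = (\int[mu3]_(y in A `&` tet) (density y)%:E)%E) ->
  nu [set: space] = 1%E ->
  measurable_fun [set: space] g -> mu3.-integrable tet (EFin \o g) ->
  nu.-integrable [set: space] (EFin \o quadrature g c) /\
  (\int[nu]_y (quadrature g c y)%:E = \int[mu3]_(y in tet) (g y)%:E)%E.
Proof.
move=> nuE nu1 mg ig; have mT := measurable_tetrahedron R.
pose k (y : space) : R := \sum_(A <- rots R) g (act A y) - 12 * c.
have mk : measurable_fun [set: space] k.
  apply: measurable_funB => //; apply: measurable_sum => A.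
  by apply: measurableT_comp => //; exact: measurable_act.
pose cst3 (r : R) : space -> \bar R := fun=> r%:E.
have ic : mu3.-integrable tet (cst3 (- (12 * c))%R).
  apply: measurable_bounded_integrable => //; first exact: borel3_tetrahedron_lty.
  exact: bounded_cst.
pose rot (i : 'I_12) := tnth (in_tuple (rots R)) i.
pose s (y : space) : \bar R := (\sum_(i < 12) (g (act (rot i) y))%:E)%E.
have ig' i : mu3.-integrable tet (fun y => (g (act (rot i) y))%:E) /\
    (\int[mu3]_(y in tet) (g (act (rot i) y))%:E =
     \int[mu3]_(y in tet) (g y)%:E)%E.
  apply: integral_act => //; rewrite rotation_groupE; exact: mem_tnth.
have int_s : mu3.-integrable tet s.
  by apply: integrable_sum => // i _; have [] := ig' i.
have kE : EFin \o k = (s \+ (cst3 (- (12 * c))%R))%E.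
  by apply/funext => y; rewrite /k /s /= big_tnth sumEFin.
have ik : mu3.-integrable tet (EFin \o k) by rewrite kE; exact: integrableD.
have [iwk wkE] := integral_w1 nuE mk ik.
have icn : nu.-integrable [set: space] (cst3 (8 / 3 * c)%R).
  exact: finite_measure_integrable_cst.
have QE : EFin \o quadrature g c =
    ((fun y => (w1 y * k y)%:E) \+ (cst3 (8 / 3 * c)%R))%E.
  by apply/funext => y; rewrite /quadrature /= EFinD.
split; first by rewrite QE; exact: integrableD.
transitivity (\int[nu]_y ((w1 y * k y)%:E + cst3 (8 / 3 * c)%R y))%E.
  by apply: eq_integral.
have icnE : (\int[nu]_y cst3 (8 / 3 * c)%R y = (8 / 3 * c)%:E)%E.
  apply: etrans (@integral_cst _ _ _ nu setT measurableT (8 / 3 * c)%:E) _.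
  by rewrite -[RHS]mule1; congr (_ * _)%E.
rewrite integralD// wkE icnE.
have -> : (\int[mu3]_(y in tet) (k y)%:E =
    12%:E * \int[mu3]_(y in tet) (g y)%:E + (- (12 * c) * (8 / 3))%:E)%E.
  transitivity (\int[mu3]_(y in tet) (s y + cst3 (- (12 * c))%R y))%E.
    by apply: eq_integral => y _; have /(congr1 (@^~ y)) := kE.
  rewrite integralD//; congr (_ + _)%E.
    rewrite integral_sum//; last by move=> i; have [] := ig' i.
    rewrite (eq_bigr (fun=> \int[mu3]_(y in tet) (g y)%:E))%E; last first.
      by move=> i _; have [] := ig' i.
    by rewrite sumr_const card_ord mule_natl.
  apply: etrans (@integral_cst _ _ _ mu3 _ mT (- (12 * c))%:E) _.
  by rewrite EFinM; congr (_ * _)%E; exact: borel3_tetrahedron.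
have Ifin : (\int[mu3]_(y in tet) (g y)%:E)%E \is a fin_num.
  exact: (integrable_fin_num mT ig).
move: Ifin; case: (\int[mu3]_(y in tet) (g y)%:E)%E => // r _.
by apply: (congr1 EFin); rewrite /=; field.
Qed.

End Unbiased.

(** * Unbiasedness for Lebesgue integrable functions *)

Section Rule.
Context (R : realType) (d : measure_display) (Omega : measurableType d).
Variable P : probability Omega R.
Local Notation mR := (measurableTypeR R).
Local Notation space := (mR * mR * mR)%type.
Local Notation la := (@lebesgue_measure R).
Local Notation mu3 := (product_sigma_finite (product_sigma_finite la la) la).
Local Notation tet := (tetrahedron R : set space).
Variable X : {mfun Omega >-> space}.
Hypothesis XT : forall omega, tetrahedron R (X omega).
Hypothesis XE : forall A, measurable A ->
  P (X @^-1` A) = (\int[mu3]_(y in A `&` tet) (density y)%:E)%E.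

Lemma QME (x : R * R * R) (f : R * R * R -> R) :
  QM x f = quadrature f (f (origin R)) x.
Proof. by rewrite /QM rotation_group_sum. Qed.

Lemma lebesgue3_integrable_borel (f : R * R * R -> R) :
  (lebesgue3 R).-integrable (tetrahedron R) (EFin \o f) ->
  exists (g : space -> R) (N : set space),
    [/\ measurable_fun [set: space] g, mu3.-integrable tet (EFin \o g),
        measurable N, mu3 N = 0%E &
        forall y, tet y -> ~ N y -> g y = f y] /\
    (\int[mu3]_(y in tet) (g y)%:E =
         \int[lebesgue3 R]_(y in tetrahedron R) (f y)%:E)%E.
Proof.
move=> intf; have mT := measurable_tetrahedron R.
have mf : measurable_fun (tet : set (caratheodory_type (mu3^*)%mu)) f.
  by apply/measurable_EFinP; exact: (measurable_int _ intf).
have [g [N [mg mN N0 gf]]] :=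
  completion_measurable_fun_ae mT (borel3_tetrahedron_lty R) mf.
exists g, N.
have mgT : measurable_fun tet (EFin \o g).
  by apply/measurable_EFinP; exact: measurable_funTS.
have ae : ae_eq (@completed_measure_extension _ _ _ mu3) tet (EFin \o g) (EFin \o f).
  by apply: (ae_eq_completion mT mN N0) => y Ty Ny /=; rewrite gf.
have mgc :
  measurable_fun (tet : set (caratheodory_type (mu3^*)%mu)) (EFin \o g).
  exact: measurable_fun_completion.
have mfc :
  measurable_fun (tet : set (caratheodory_type (mu3^*)%mu)) (EFin \o f).
  exact: (measurable_int _ intf).
have mTc := measurable_completion mu3 mT.
have gfE : (\int[mu3]_(y in tet) (g y)%:E =
    \int[lebesgue3 R]_(y in tetrahedron R) (f y)%:E)%E.
  rewrite -(integral_completion mu3 mT mgT).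
  (* [lebesgue3] is the completion of [mu3] by conversion; [mu3] only adds the sigma-finite
     structure. *)
  transitivity
    (\int[@completed_measure_extension _ _ _ mu3]_(y in tet) (f y)%:E)%E => //.
  exact: (ae_eq_integral _ _ mTc mgc mfc ae).
split => //; split => //; apply/integrableP; split => //.
have /integrableP[_] := intf; apply: le_lt_trans.
have mabs : measurable_fun tet (fun y => `|(g y)%:E|%E) by exact: measurableT_comp.
rewrite -(ge0_integral_completion mu3 mT mabs (fun _ _ => abse_ge0 _)).
rewrite le_eqVlt; apply/orP; left; apply/eqP.
by apply: (ae_eq_integral _ _ mTc _ _ (ae_eq_abse ae)); exact: measurableT_comp.
Qed.

Lemma distribution_null (N : set space) : measurable N -> mu3 N = 0%E ->
  P (X @^-1` N) = 0%E.
Proof. by move=> mN N0; apply: (law_null (nu := distribution P X)). Qed.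

Lemma QM_unbiased : unbiased P (tetrahedron R) (fun omega => QM (X omega)).
Proof.
move=> f /lebesgue3_integrable_borel[g [N [[mg ig mN N0 gf] gfE]]].
(* If the random point avoids [M], then none of its 12 images lies in [N]. *)
pose M := \bigcup_(i in `I_12) (act (nth 0 (rots R) i) @^-1` N).
have mact (i : nat) : measurable (act (nth 0 (rots R) i) @^-1` N : set space).
  by rewrite -[X in measurable X]setTI; exact: measurable_act.
have mM : measurable M by apply: bigcup_measurable => i _; exact: mact.
have M0 : mu3 M = 0%E.
  apply: measure_negligible => //; rewrite /M bigcup_mkcond.
  apply: negligible_bigcup => i; case: ifPn => [|_]; last exact: negligible_set0.
  rewrite inE => /= i12; apply/negligibleP => //; rewrite -[RHS]N0.
  have GA : rotation_group R (nth 0 (rots R) i).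
    by rewrite rotation_groupE /=; exact: mem_nth.
  by have [_ /(_ _ mN)] := borel3_rotation GA.
pose nu : {finite_measure set space -> \bar R} := distribution P X.
have nuE A : measurable A -> nu A = (\int[mu3]_(y in A `&` tet) (density y)%:E)%E.
  by move=> mA; rewrite -XE.
have nu1 : nu [set: space] = 1%E by exact: (@probability_setT _ _ _ P).
have [iq qE] := integral_quadrature (f (origin R)) nuE nu1 mg ig.
have mX : measurable_fun setT X by exact: measurable_funPT.
have mq := measurable_int _ iq.
pose q := quadrature g (f (origin R)).
have iqX : P.-integrable [set: Omega] (fun omega => (q (X omega))%:E).
  have /integrableP[mqE qoo] := iq; apply/integrableP; split.
    exact: (measurableT_comp mqE).
  apply: le_lt_trans qoo; rewrite le_eqVlt; apply/orP; left; apply/eqP.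
  apply/esym; apply: (ge0_integral_pushforward mX P measurableT).
    exact: measurableT_comp.
  by move=> y _; exact: abse_ge0.
have qXE : (\int[P]_omega (q (X omega))%:E = \int[nu]_y (q y)%:E)%E.
  by rewrite integral_pushforward.
have mXM : measurable (X @^-1` M) by rewrite -[X in measurable X]setTI; exact: mX.
have [||] := @integral_completion_ae _ _ _ P setT (X @^-1` M)
  (fun omega => (q (X omega))%:E) (fun omega => (QM (X omega) f)%:E)
   measurableT mXM (distribution_null mM M0).
- move=> omega _ XM; rewrite QME /q /quadrature; congr (_ * (_ - _) + _)%:E.
  apply: eq_big_seq => A rA; apply: gf.
    have GA : rotation_group R A by rewrite rotation_groupE.
    by have := preimage_act_tetrahedron GA; move=> /seteqP[_]; apply; exact: XT.
  move=> NA; apply: XM; exists (index A (rots R)); first by rewrite -index_mem in rA.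
  by rewrite /preimage /mkset nth_index.
- exact: iqX.
by move=> iQ QE; split => //; rewrite QE qXE qE gfE.
Qed.

End Rule.

(** * Exactness in degree 2 and the form of the rule *)

Section Order.
Variable R : realType.
Local Notation mR := (measurableTypeR R).
Local Notation space := (mR * mR * mR)%type.
Local Notation la := (@lebesgue_measure R).
Local Notation mu3 := (product_sigma_finite (product_sigma_finite la la) la).
Local Notation tet := (tetrahedron R : set space).

Lemma measurable_monomial3 i j k :
  measurable_fun [set: space] (@monomial3 R i j k : space -> mR).
Proof.
by apply: measurable_funM; [apply: measurable_funM|];
  apply: measurable_funX => //; exact: measurableT_comp.
Qed.

Lemma normr_monomial3_le1 i j k x :
  tetrahedron R x -> `|monomial3 i j k x| <= 1.
Proof.
case: x => [[u v] w] /tetrahedron3[h0 h1 h2 h3].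
rewrite /monomial3 /= !normrM !normrX.
have pow (t : R) n : `|t| <= 1 -> 0 <= `|t| ^+ n <= 1.
  by move=> t1; rewrite exprn_ge0//= exprn_ile1.
have /(pow _ i)/andP[u0 u1] : `|u| <= 1 by rewrite ler_norml; apply/andP; split; lra.
have /(pow _ j)/andP[v0 v1] : `|v| <= 1 by rewrite ler_norml; apply/andP; split; lra.
have /(pow _ k)/andP[w0 w1] : `|w| <= 1 by rewrite ler_norml; apply/andP; split; lra.
by rewrite mulr_ile1// ?mulr_ge0// mulr_ile1.
Qed.

Lemma integrable_meval (q : mpoly.mpoly 3 R) : (lebesgue3 R).-integrable
  (tetrahedron R) (EFin \o (fun x => mpoly.meval (coordinate x) q)).
Proof.
have mT := measurable_tetrahedron R.
have [mq bq] :
    measurable_fun [set: space] (fun x => mpoly.meval (coordinate x) q : mR) /\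
    [bounded mpoly.meval (coordinate x) q | x in tet].
  split.
    apply: (eq_measurable_fun (fun x : space => \sum_(m <- mpoly.msupp q)
       mpoly.mcoeff m q * monomialm m x : mR)).
      by move=> x _; rewrite meval3.
    apply: measurable_sum => m; apply: measurable_funM => //.
    exact: measurable_monomial3.
  exists (\sum_(m <- mpoly.msupp q) `|mpoly.mcoeff m q|); split => [|N N0 x Tx].
    exact: num_real.
  rewrite /= meval3; apply: le_trans (ltW N0).
  apply: le_trans (ler_norm_sum _ _ _) _; apply: ler_sum => m _.
  by rewrite normrM ler_piMr//; exact: normr_monomial3_le1.
apply: (integrable_completion (mu := mu3) mT).
apply: measurable_bounded_integrable => //; first exact: borel3_tetrahedron_lty.
exact: measurable_funTS.
Qed.

Context (d : measure_display) (Omega : measurableType d).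
Variable P : probability Omega R.
Variable X : {mfun Omega >-> space}.
Hypothesis XT : forall omega, tetrahedron R (X omega).
Hypothesis XE : forall A, measurable A ->
  P (X @^-1` A) = (\int[mu3]_(y in A `&` tet) (density y)%:E)%E.

(* On a polynomial of degree at most 2 the rule is almost surely constant, so that
   exactness follows from unbiasedness. *)
Lemma QM_of_order2 : of_order P (tetrahedron R) 2 (fun omega => QM (X omega)).
Proof.
have m0 : measurable ([set origin R] : set space) by exact: measurable_origin.
have mX : measurable_fun setT X by exact: measurable_funPT.
have mN : measurable (X @^-1` [set origin R]).
  by rewrite -[X in measurable X]setTI; exact: mX.
have N0 : P (X @^-1` [set origin R]) = 0%E.
  exact: (distribution_null XE m0 (borel3_origin R)).
(* One exceptional event serves all polynomials, as [of_order] quantifies over [q] inside the almost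
   sure statement. *)
exists (X @^-1` [set origin R]); split => // omega /= Qq.
apply: contrapT => Xomega; apply: Qq => q q3.
have [e eE] := isotropic_meval q3.
set f := fun x => mpoly.meval (coordinate x) q.
(* By isotropy the bracket in the rule is [e |x|^2], and [w1] cancels [|x|^2]. *)
pose c := 2 / 15 * e + 8 / 3 * f (origin R).
have Qc omega' : ~ X omega' = origin R -> QM (X omega') f = c.
  move=> X0; rewrite QME /quadrature eE /w1 /c /f.
  have s0 : sqnorm (X omega') != 0 by apply/eqP => /sqnorm_eq0.
  by field.
have [_ QE] := QM_unbiased XT XE (integrable_meval q).
rewrite -QE Qc//.
have [||_ ->] := @integral_completion_ae _ _ _ P setT (X @^-1` [set origin R])
  (cst c%:E) (fun omega => (QM (X omega) f)%:E) measurableT mN N0.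
- by move=> omega' _ /Qc ->.
- exact: finite_measure_integrable_cst.
apply/esym; apply: etrans (@integral_cst _ _ _ P setT measurableT c%:E) _.
by rewrite -[RHS]mule1; congr (_ * _)%E; exact: probability_setT.
Qed.

Lemma QM_stochastic_quadrature :
  stochastic_quadrature (tetrahedron R) 13 (fun omega => QM (X omega)).
Proof.
have mX : measurable_fun setT X by exact: measurable_funPT.
(* The index 12 stands for the origin, whose weight collects both terms in [f(0)]. *)
pose w (i : nat) omega :=
  if (i < 12)%N then w1 (X omega) else 8 / 3 - 12 * w1 (X omega).
pose y (i : nat) omega := act (nth 0 (rots R) i) (X omega).
pose x (i : nat) omega := if (i < 12)%N then y i omega else origin R.
exists (fun i : 'I_13 => x i), (fun i : 'I_13 => w i).
split.
- move=> i; rewrite /x; case: (nat_of_ord i < 12)%N => //.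
  exact: (measurableT_comp (measurable_act (nth 0 (rots R) i)) mX).
- move=> i; rewrite /w; case: (nat_of_ord i < 12)%N => //.
    exact: (measurableT_comp (measurable_w1 R) mX).
  apply: measurable_funB; first exact: measurable_cst.
  apply: measurable_funM; first exact: measurable_cst.
  exact: (measurableT_comp (measurable_w1 R) mX).
- move=> i omega; rewrite /x; case: ifP => i12.
    have GA : rotation_group R (nth 0 (rots R) i).
      by rewrite rotation_groupE; exact: mem_nth.
    by have := preimage_act_tetrahedron GA; move=> /seteqP[_]; apply; exact: XT.
  by apply/tetrahedron3; rewrite !addr0 !subr0 ler01.
- move=> omega f; rewrite big_ord_recr /= /x /w /= QME /quadrature.
  rewrite (eq_bigr (fun i : 'I_12 => f (y i omega) * w1 (X omega))).
    rewrite -mulr_suml -(big_mkord xpredT (fun i => f (y i omega))) /y.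
    rewrite -[12%N]/(size (rots R)).
    rewrite -(big_nth 0 xpredT (fun A => f (act A (X omega)))).
    by ring.
  by move=> i _; rewrite ltn_ord.
Qed.

End Order.

Theorem mainTheorem4 (R : realType) (d : measure_display)
    (Omega : measurableType d) (P : probability Omega R)
    (x : {RV P >-> (R * R * R)%type})
    (x_in_T : forall omega, tetrahedron R (x omega))
    (x_density : forall A : set (R * R * R)%type, measurable A ->
       (distribution P x A =
          \int[lebesgue3 R]_(y in A `&` tetrahedron R) (density y)%:E)%E) :
  let G := rotation_group R in
  let Q := fun omega => QM (x omega) in
  [/\ (G #= `I_12)%card,
      G = generated [set R1 R; R2 R],
      stochastic_quadrature (tetrahedron R) 13 Q,
      of_order P (tetrahedron R) 2 Q &
      unbiased P (tetrahedron R) Q].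
Proof.
(* The random point is repackaged with values in the product of copies of [measurableTypeR R], on
   which the product Lebesgue measure is built. *)
pose space := (measurableTypeR R * measurableTypeR R * measurableTypeR R)%type.
have mx : @measurable_fun _ _ Omega space setT x by exact: (measurable_funPT x).
pose X : {mfun Omega >-> space} :=
  MeasurableFun.Pack (MeasurableFun.Class
    (isMeasurableFun.Build _ _ Omega space x mx)).
have XT omega : tetrahedron R (X omega) by exact: x_in_T.
have XE (A : set space) : measurable A -> P (X @^-1` A) =
    (\int[product_sigma_finite (product_sigma_finite (@lebesgue_measure R)
      (@lebesgue_measure R)) (@lebesgue_measure R)]_(y in A `&` tetrahedron R)
      (density y)%:E)%E.
  move=> mA; apply: etrans (x_density A mA) _.
  apply: ge0_integral_completion.
  - by apply: measurableI => //; exact: measurable_tetrahedron.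
  - apply/measurable_EFinP; apply: measurable_funTS; exact: measurable_density.
  - by move=> y _; rewrite lee_fin mulr_ge0// ?divr_ge0// sqnorm_ge0.
split.
- exact: rotation_group_card.
- exact: rotation_group_generated.
- exact: (QM_stochastic_quadrature XT).
- exact: (QM_of_order2 XT XE).
- exact: (QM_unbiased XT XE).
Qed.
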